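(* There exists a nonreflexive $1$-Grothendieck Banach space which does not contain $\ell_\infty$.
   Context: ''Does not contain $\ell_\infty$'' means that the space does not contain an isomorphic copy of $\ell_\infty$, i.e. no closed subspace is linearly homeomorphic to $\ell_\infty$. For a Banach space $X$ (real or complex), $B_X$ denotes its closed unit ball, $X^{\ast}$ its dual and $X^{\ast\ast}$ its bidual. For a sequence $(a_n)$ of scalars, $\mathrm{clust}(a_n)$ is the set of all its cluster points. For a bounded sequence $(x_n^{\ast})_{n\in\mathbb{N}}$ in $X^{\ast}$ put $$\delta_{w^{\ast}}(x_n^{\ast}):=\sup\{\mathrm{diam}\,\mathrm{clust}(x_n^{\ast}(x)) : x\in B_X\},\qquad \delta_{w}(x_n^{\ast}):=\sup\{\mathrm{diam}\,\mathrm{clust}(x^{\ast\ast}(x_n^{\ast})) : x^{\ast\ast}\in B_{X^{\ast\ast}}\}.$$ For $c\geq 1$, $X$ is called $c$-Grothendieck if $\delta_w(x_n^{\ast})\leq c\,\delta_{w^{\ast}}(x_n^{\ast})$ for every bounded sequence $(x_n^{\ast})_{n\in\mathbb{N}}$ in $X^{\ast}$. *)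

(* Defs.v *)
From HB Require Import structures.
From mathcomp Require Import all_boot all_order all_algebra.
From mathcomp Require Import complex.
From mathcomp Require Import all_classical all_reals all_analysis.

Set Implicit Arguments.
Unset Strict Implicit.
Unset Printing Implicit Defensive.

Import Order.TTheory GRing.Theory Num.Theory.
Import numFieldNormedType.Exports.

Local Open Scope classical_set_scope.
Local Open Scope ring_scope.

Variant scalars := RealScalars | ComplexScalars.

Definition scalar_field (R : realType) (s : scalars) : numFieldType :=
  match s with RealScalars => R | ComplexScalars => R[i] end.

(* Norms in a normed module over K are elements of K.  On complex numbers the
   order of MathComp is partial: x <= y iff y - x is a nonnegative real.  Hence
   the supremum of a nonempty bounded set of nonnegative scalars is the usual
   real supremum (lemma [nneg_supremums]); for K = R, [supremum 0] is [sup]. *)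
Section nneg_sup.
Context {R : realType} {s : scalars}.
Local Notation K := (scalar_field R s).

Lemma nneg_supremums (A : set K) : A !=set0 -> (forall a, A a -> 0 <= a) ->
  has_ubound A -> supremums A !=set0.
Proof.
case: s A => /= A A0 Ann [M AM].
  exists (sup A); split; first by apply: ub_le_sup; exists M.
  by move=> y Ay; apply: ge_sup.
have cR (a : R[i]) : 0 <= a -> a = (complex.Re a)%:C%C.
  by case: a => a b; rewrite lecE /= => /andP[/eqP -> _].
pose B : set R := [set complex.Re a | a in A].
have B0 : B !=set0 by case: A0 => a Aa; exists (complex.Re a), a.
have ubB (y : R[i]) : ubound A y -> ubound B (complex.Re y).
  move=> Ay _ [a Aa <-]; have := Ay _ Aa.
  by rewrite lecE => /andP[].
have supB : has_sup B by split=> //; exists (complex.Re M); exact: ubB.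
exists (sup B)%:C%C; split.
  move=> a Aa; rewrite (cR a (Ann _ Aa)) lecR.
  by apply: ub_le_sup; [case: supB | exists a].
move=> y Ay; have y0 : 0 <= y.
  by case: A0 => a Aa; exact: le_trans (Ann _ Aa) (Ay _ Aa).
rewrite (cR _ y0) lecR; apply: ge_sup => //; exact: ubB.
Qed.

Definition sup_norm (T : Type) (D : set T) (f : T -> K) : K :=
  supremum 0 [set `|f t| | t in D].

Section sup_norm_theory.
Variables (T : Type) (D : set T).
Hypothesis D0 : D !=set0.
Implicit Types f g : T -> K.

Let bounded f := exists M, forall t, D t -> `|f t| <= M.

Let sup_normP f : bounded f -> supremums [set `|f t| | t in D] (sup_norm D f).
Proof.
case=> M fM; rewrite /sup_norm /supremum ifF; last first.
  apply/negP => /eqP /seteqP[/(_ `|f (projT1 (cid D0))|) + _].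
  by apply; exists (projT1 (cid D0)) => //; exact: (projT2 (cid D0)).
case: xgetP => [y -> //|noS].
have [] := @nneg_supremums [set `|f t| | t in D].
- by case: D0 => t Dt; exists `|f t|, t.
- by move=> _ [t _ <-].
- by exists M => _ [t Dt <-]; exact: fM.
- by move=> y /noS.
Qed.

Lemma le_sup_norm f t : bounded f -> D t -> `|f t| <= sup_norm D f.
Proof. by move=> /sup_normP[+ _] Dt; apply; exists t. Qed.

Lemma sup_norm_le f M : (forall t, D t -> `|f t| <= M) -> sup_norm D f <= M.
Proof.
move=> fM; have /sup_normP[_ ->//] : bounded f by exists M.
by move=> _ [t Dt <-]; exact: fM.
Qed.

Lemma sup_normD f g : bounded f -> bounded g ->
  sup_norm D (fun t => f t + g t) <= sup_norm D f + sup_norm D g.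
Proof.
move=> bf bg; apply: sup_norm_le => t Dt.
by rewrite (le_trans (ler_normD _ _))// lerD// le_sup_norm.
Qed.

Let sup_normZ_le (l : K) f : bounded f ->
  sup_norm D (fun t => l * f t) <= `|l| * sup_norm D f.
Proof.
move=> bf; apply: sup_norm_le => t Dt.
by rewrite normrM ler_wpM2l// le_sup_norm.
Qed.

Lemma sup_normZ (l : K) f : bounded f ->
  sup_norm D (fun t => l * f t) = `|l| * sup_norm D f.
Proof.
move=> bf; apply/eqP; rewrite eq_le sup_normZ_le//=.
have [->|l0] := eqVneq l 0.
  rewrite normr0 mul0r; case: D0 => t Dt.
  apply: (@le_trans _ _ `|0 * f t|) => //.
  apply: (@le_sup_norm (fun t => 0 * f t)) => //.
  by exists 0 => u _; rewrite mul0r normr0.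
rewrite -ler_pdivlMl ?normr_gt0// -normfV.
have blf : bounded (fun t => l * f t).
  case: bf => M fM; exists (`|l| * M) => t Dt.
  by rewrite normrM ler_wpM2l// fM.
rewrite [X in sup_norm D X <= _](_ : f = (fun t => l^-1 * (l * f t))).
  exact: sup_normZ_le.
by apply/funext => t; rewrite mulKf.
Qed.

Lemma sup_norm_eq0 f : bounded f -> sup_norm D f = 0 ->
  forall t, D t -> f t = 0.
Proof.
move=> bf f0 t Dt; apply/eqP; rewrite -normr_le0 -f0.
exact: le_sup_norm.
Qed.

End sup_norm_theory.
End nneg_sup.

Definition unit_ball (K : numFieldType) (X : normedModType K) : set X :=
  [set x | `|x| <= 1].
Arguments unit_ball {K} X.

Section dual.
Context {R : realType} {s : scalars}.
Local Notation K := (scalar_field R s).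
Variable X : normedModType K.

Definition continuous_functional : {pred X -> K^o} :=
  [pred f | `[< linear f /\ continuous f >]].

Lemma continuous_functional_submod_closed :
  submod_closed continuous_functional.
Proof.
split=> [|a f g /asboolP[lf cf] /asboolP[lg cg]]; apply/asboolP; split.
- by move=> b u v; rewrite /= scaler0 addr0.
- exact: cst_continuous.
- move=> b u v; rewrite !fctE lf lg !scalerDr addrACA.
  by rewrite !scalerA [a * b]mulrC.
- by move=> x; apply: cvgD; [apply: cvgZr; exact: cf | exact: cg].
Qed.

HB.instance Definition _ := GRing.isSubmodClosed.Build K (X -> K^o)
  continuous_functional continuous_functional_submod_closed.

Record dual := Dual {
  dual_fun :> X -> K^o;
  dual_funP : dual_fun \in continuous_functional }.

HB.instance Definition _ := [isSub for dual_fun].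
HB.instance Definition _ := [Choice of dual by <:].
HB.instance Definition _ := [SubChoice_isSubLmodule of dual by <:].

Lemma dual_addE (f g : dual) x : (f + g) x = f x + g x.
Proof. by rewrite -[dual_fun _]/(val (f + g)) GRing.valD. Qed.

Lemma dual_scaleE a (f : dual) x : (a *: f) x = a * f x.
Proof. by rewrite -[dual_fun _]/(val (a *: f)) GRing.valZ. Qed.

Definition dual_norm (f : dual) : K := sup_norm (unit_ball X) f.

Let ball0 : unit_ball X !=set0.
Proof. by exists 0; rewrite /unit_ball/= normr0. Qed.

Lemma dual_bounded (f : dual) :
  exists M, forall x, unit_ball X x -> `|f x| <= M.
Proof.
have /asboolP[lf cf] := dual_funP f.
pose g : {linear X -> K^o} := HB.pack (dual_fun f)
  (GRing.isLinear.Build K X K^o *:%R (dual_fun f) lf).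
have /linear_bounded_continuous/bounded_funP/(_ 1)[M gM] : continuous g by [].
by exists M => x; exact: gM.
Qed.

Let ler_dual_normD f g : dual_norm (f + g) <= dual_norm f + dual_norm g.
Proof.
rewrite /dual_norm (_ : dual_fun (f + g) = (fun x => f x + g x)).
  exact: (sup_normD ball0 (dual_bounded f) (dual_bounded g)).
by apply/funext => x; rewrite dual_addE.
Qed.

Let dual_normZ a f : dual_norm (a *: f) = `|a| * dual_norm f.
Proof.
rewrite /dual_norm (_ : dual_fun (a *: f) = (fun x => a * f x)).
  exact: (sup_normZ ball0 a (dual_bounded f)).
by apply/funext => x; rewrite dual_scaleE.
Qed.

Let dual_norm0_eq0 f : dual_norm f = 0 -> f = 0.
Proof.
move=> f0; apply/val_inj/funext => x /=.
have /asboolP[lf cf] := dual_funP f.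
pose g : {linear X -> K^o} := HB.pack (dual_fun f)
  (GRing.isLinear.Build K X K^o *:%R (dual_fun f) lf).
have [->|x0] := eqVneq x 0; first exact: (linear0 g).
have := sup_norm_eq0 ball0 (dual_bounded f) f0 (t := `|x|^-1 *: x).
rewrite /unit_ball/= normrZ normfV normr_id mulVf ?normr_eq0// => /(_ (lexx _)).
rewrite -[dual_fun f]/(g : X -> K^o) linearZ/= => /eqP.
by rewrite mulf_eq0 invr_eq0 normr_eq0 (negbTE x0) => /eqP.
Qed.

HB.instance Definition _ := Lmodule_isNormed.Build K dual
  ler_dual_normD dual_normZ dual_norm0_eq0.

End dual.

Section linfty.
Variables (R : realType) (s : scalars).
Local Notation K := (scalar_field R s).

Definition bounded_seq : {pred nat -> K^o} :=
  [pred u | `[< exists M, forall n, `|u n| <= M >]].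

Lemma bounded_seq_submod_closed : submod_closed bounded_seq.
Proof.
split=> [|a u v /asboolP[M uM] /asboolP[N vN]]; apply/asboolP.
  by exists 0 => n; rewrite /= normr0.
exists (`|a| * M + N) => n; rewrite (le_trans (ler_normD _ _))//.
by rewrite lerD// normrM ler_wpM2l.
Qed.

HB.instance Definition _ := GRing.isSubmodClosed.Build K (nat -> K^o)
  bounded_seq bounded_seq_submod_closed.

Record linfty := Linfty {
  linfty_seq :> nat -> K^o;
  linfty_seqP : linfty_seq \in bounded_seq }.

HB.instance Definition _ := [isSub for linfty_seq].
HB.instance Definition _ := [Choice of linfty by <:].
HB.instance Definition _ := [SubChoice_isSubLmodule of linfty by <:].

Lemma linfty_addE (u v : linfty) n : (u + v) n = u n + v n.
Proof. by rewrite -[linfty_seq _]/(val (u + v)) GRing.valD. Qed.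

Lemma linfty_scaleE a (u : linfty) n : (a *: u) n = a * u n.
Proof. by rewrite -[linfty_seq _]/(val (a *: u)) GRing.valZ. Qed.

Definition linfty_norm (u : linfty) : K := sup_norm setT u.

Let setT0 : [set: nat] !=set0. Proof. by exists 0%N. Qed.

Let linfty_bounded (u : linfty) :
  exists M, forall n, [set: nat] n -> `|u n| <= M.
Proof. by have /asboolP[M uM] := linfty_seqP u; exists M => n _. Qed.

Let ler_linfty_normD u v : linfty_norm (u + v) <= linfty_norm u + linfty_norm v.
Proof.
rewrite /linfty_norm (_ : linfty_seq (u + v) = (fun n => u n + v n)).
  exact: (sup_normD setT0 (linfty_bounded u) (linfty_bounded v)).
by apply/funext => n; rewrite linfty_addE.
Qed.

Let linfty_normZ a u : linfty_norm (a *: u) = `|a| * linfty_norm u.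
Proof.
rewrite /linfty_norm (_ : linfty_seq (a *: u) = (fun n => a * u n)).
  exact: (sup_normZ setT0 a (linfty_bounded u)).
by apply/funext => n; rewrite linfty_scaleE.
Qed.

Let linfty_norm0_eq0 u : linfty_norm u = 0 -> u = 0.
Proof.
move=> u0; apply/val_inj/funext => n.
exact: (sup_norm_eq0 setT0 (linfty_bounded u) u0).
Qed.

HB.instance Definition _ := Lmodule_isNormed.Build K linfty
  ler_linfty_normD linfty_normZ linfty_norm0_eq0.

End linfty.

Section grothendieck.
Context {R : realType} {s : scalars}.
Local Notation K := (scalar_field R s).

Definition clust (a : nat -> K) : set K := cluster ((a : nat -> K^o) @ \oo).

Definition diam (A : set K) : K :=
  supremum 0 [set `|p.1 - p.2| | p in A `*` A].

Variable X : normedModType K.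

(* The next two suprema are used for bounded f only: the cluster sets are then
   nonempty and uniformly bounded, so no infinite value can occur. *)
Definition delta_weak_star (f : nat -> dual X) : K :=
  supremum 0 [set diam (clust (fun n => f n x)) | x in unit_ball X].

Definition delta_weak (f : nat -> dual X) : K :=
  supremum 0 [set diam (clust (fun n => F (f n)))
                | F in unit_ball (dual (dual X))].

Definition grothendieck (c : K) : Prop :=
  forall f : nat -> dual X, bounded_fun f ->
    delta_weak f <= c * delta_weak_star f.

Definition reflexive_space : Prop :=
  forall F : dual (dual X), exists x : X, forall f : dual X, F f = f x.

(* T is a linear homeomorphism of l^oo onto the closed subspace [range T];
   S restricted to that subspace is its inverse. *)
Definition contains_linfty : Prop :=
  exists (T : {linear linfty R s -> X}) (S : X -> linfty R s),
    [/\ closed (range T), continuous T, cancel T S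
      & {within range T, continuous S}].

End grothendieck.

(* Main.v *)
Require Import Defs.
From HB Require Import structures.
From mathcomp Require Import all_boot all_order all_algebra.
From mathcomp Require Import complex.
From mathcomp Require Import all_classical all_reals all_analysis.
From mathcomp Require Import ring lra.
From mathcomp Require wochoice.

(** Take an algebra of subsets of [nat] that contains the singletons, and let
    the space consist of the uniform limits of the functions on [nat] which are
    measurable for it and take finitely many values; this is C(K) for the Stone
    space K of the algebra.  Haydon's algebra has two properties which pull in
    opposite directions.  It is rich: out of every sequence of pairwise
    disjoint blocks, each cut into pieces from the algebra, one can select an
    infinite subsequence such that for each label the union of the selected
    pieces with that label is in the algebra.  It is also poor: no infinite set
    M of integers has all its subsets as traces of members of the algebra.

    The algebra is generated by a transfinite recursion of continuum length
    ([haydon_algebra]).  A stage chooses for one set M a subset that is not yet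
    a trace, and adds the unions for one sequence of blocks, over a branch of
    the binary tree.  Two branches share finitely many nodes.  Hence if two of
    them spoil the same earlier choice in the same way, that choice was spoilt
    already before the stage ([new_generator]); and there are more branches
    than ways to spoil.  Instead of cardinal arithmetic, this uses only that the
    earlier stages, through finite trees over them, do not enumerate all
    stages; [exists_small_well_order] arranges this.

    Poverty excludes l^oo.  An embedding of l^oo is bounded below on the unit
    vectors, say at the points n_k of [nat]; by Rosenthal's lemma, on an
    infinite set of indices k the other coordinates have little influence at
    n_k, and then the images of indicator functions trace every subset of an
    infinite set of points n_k ([hspace_no_linfty]).  The space is not
    reflexive because the bidual functional that sends phi to the ultrafilter
    limit of its values at the indicators of [n, oo) kills all point
    evaluations, but not the limit along a free ultrafilter
    ([hspace_not_reflexive]).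

    Richness gives the Grothendieck property with constant 1.  Let F be in the
    unit ball of the bidual, and suppose that F(phi_n) has two cluster points
    at distance d.  Differences of the phi_n along two subsequences, rotated,
    are functionals L_k with Re F(L_k) at least d, up to a small error.  It
    suffices to find x in the unit ball with Re L_k(x) > d - e for infinitely
    many k ([recurrent_point]), since then phi_n(x) has two cluster points at
    distance d - e.  Let lambda be the limit of the variations |L_k| along a
    free ultrafilter, an additive set function, and let eta be the largest mass
    that |L_k| keeps, for ultrafilter many k, on sets of arbitrarily small
    lambda-measure ([modulus]).  One can choose disjoint sets P_i on which
    |L_(k_i)| has mass about eta, with functions h_i living there that realise
    it ([disjoint_humps]).  Off P_i, L_(k_i) is uniformly absolutely continuous
    with respect to lambda.  By Helly's theorem every finite set of the L_k is
    at least d, up to e, at a common point of the ball; points of nearly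
    minimal norm in L^2(lambda) among these form a Cauchy sequence, so a single
    x0 is close to points that serve any given L_k ([central_point]), and
    Re L_(k_i) is at least about d - eta on the part of x0 off P_i.  Finally x is h_i on P_i for i in an
    infinite set, and x0 elsewhere.  Infinitely many disjoint families of
    indices are available, so the union of the selected sets P_i can be taken
    lambda-small, whence the other humps do not disturb L_(k_i). *)

Set Implicit Arguments.
Unset Strict Implicit.
Unset Printing Implicit Defensive.

Import Order.TTheory GRing.Theory Num.Theory.
Import numFieldNormedType.Exports.

Local Open Scope classical_set_scope.

(** * Smallness of initial segments *)

Inductive tree (T : Type) := Leaf of T & nat | Single of nat | Node of tree T & tree T.
Arguments Single {T}.

Fixpoint leaves_in T (S : set T) (t : tree T) : Prop :=
  match t with
  | Leaf x _ => S x
  | Single _ => True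
  | Node a b => leaves_in S a /\ leaves_in S b
  end.

Lemma leaves_in_sub T (S S' : set T) t : S `<=` S' -> leaves_in S t -> leaves_in S' t.
Proof. by move=> sub; elim: t => //= [x _ /sub //|a IHa b IHb [/IHa ? /IHb ?]]. Qed.

(** A substitute for having cardinality less than that of [T].  It is phrased
    with finite trees, that is with finite sequences and countably many labels,
    so that it is stable under the operations used below without the theorem
    that an infinite cardinal equals its square. *)
Definition small (T : Type) (S : set T) :=
  forall f : tree T -> T, exists x, forall t, leaves_in S t -> f t <> x.

Lemma small_sub T (S S' : set T) : S `<=` S' -> small S' -> small S.
Proof.
move=> sub sm f; have [x xP] := sm f; exists x => t St.
by apply: xP; exact: leaves_in_sub St.
Qed.

Section small_point.
Variables (T : Type) (p : T).

(** Trees over [S] and [p] are coded by trees over [S]: the odd numbers mark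
    the occurrences of [p]. *)
Fixpoint unmark (t : tree T) : tree T :=
  match t with
  | Leaf x i => Leaf x i
  | Single n => if odd n then Leaf p n./2 else Single n./2
  | Node a b => Node (unmark a) (unmark b)
  end.

Lemma unmark_onto (S : set T) t : leaves_in (S `|` [set p]) t ->
  exists2 t', leaves_in S t' & unmark t' = t.
Proof.
elim: t => [x i /= [Sx|->]|n _|a IHa b IHb /= [/IHa[a' Sa <-] /IHb[b' Sb <-]]].
- by exists (Leaf x i).
- by exists (Single i.*2.+1) => //=; rewrite odd_double /= uphalf_double.
- by exists (Single n.*2) => //=; rewrite odd_double doubleK.
- by exists (Node a' b').
Qed.

Lemma small_add1 (S : set T) : small S -> small (S `|` [set p]).
Proof.
move=> sm f; have [x xP] := sm (f \o unmark); exists x => t /unmark_onto[t' St' <-].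
exact: (xP t').
Qed.
End small_point.

Section small_image.
Variables (T : Type) (f : tree T -> T).

(** A tree whose leaves are images under [f] of trees is coded by one tree.  A
    node that starts with a number is a genuine node; the other nodes hold the
    label of a leaf and the tree whose image is that leaf. *)
Fixpoint expand (t : tree T) : tree T :=
  match t with
  | Node (Single _) (Node a b) => Node (expand a) (expand b)
  | Node (Node _ (Single i)) t' => Leaf (f t') i
  | Single n => Single n
  | _ => Single 0
  end.

Lemma expand_onto (S : set T) t :
  leaves_in [set f t' | t' in leaves_in S] t ->
  exists2 t', leaves_in S t' & expand t' = t.
Proof.
elim: t => [x i /= [t' St' <-]|n _|a IHa b IHb /= [/IHa[a' Sa <-] /IHb[b' Sb <-]]].
- by exists (Node (Node (Single 0) (Single i)) t').
- by exists (Single n).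
- by exists (Node (Single 0) (Node a' b')).
Qed.

Lemma small_image (S : set T) : small S -> small [set f t | t in leaves_in S].
Proof.
move=> sm g; have [x xP] := sm (g \o expand); exists x => t /expand_onto[t' St' <-].
exact: (xP t').
Qed.
End small_image.

Definition strict_well_order (T : Type) (lt : T -> T -> Prop) :=
  [/\ forall A : set T, A !=set0 -> exists2 z, A z & forall x, A x -> ~ lt x z,
      forall x, ~ lt x x,
      forall x y, lt x y \/ x = y \/ lt y x
    & forall x y z, lt x y -> lt y z -> lt x z].

Lemma exists_strict_well_order (T : eqType) :
  exists lt : T -> T -> Prop, strict_well_order lt.
Proof.
have [R wo] := wochoice.well_ordering_principle T.
have wmin (A : set T) : A !=set0 ->
    exists2 z, A z & forall x, A x -> R z x /\ (R x z -> x = z).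
  move=> [a Aa]; have [|z [[zA zmin] _]] := wo [pred x | `[< A x >]].
    by exists a; apply/asboolP.
  exists z; first by move/asboolP: zA.
  move=> x Ax; split; first by apply: zmin; apply/asboolP.
  move=> Rxz; have [|w [_ u]] := wo [pred w | (w == x) || (w == z)].
    by exists x; rewrite inE eqxx.
  have Rzx : R z x by apply: zmin; apply/asboolP.
  have Rxx : R x x.
    have [|v [[vA vmin] _]] := wo (pred1 x); first by exists x; rewrite inE.
    by move: vA vmin; rewrite inE => /eqP -> /(_ x (eqxx x)).
  have Rzz : R z z by apply: zmin.
  rewrite -(u x) ?(u z)//; split; rewrite ?inE ?eqxx ?orbT// => v.
    by rewrite !inE => /orP[] /eqP ->.
  by rewrite !inE => /orP[] /eqP ->.
have two x y : exists2 z, z = x \/ z = y & [/\ R z x, R z y,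
    R x z -> x = z & R y z -> y = z].
  have [|z zxy zP] := wmin [set w | w = x \/ w = y]; first by exists x; left.
  exists z => //; have [? ?] := zP x (or_introl erefl).
  by have [? ?] := zP y (or_intror erefl); split.
have anti x y : R x y -> R y x -> x = y.
  move=> Rxy Ryx; have [z [->|->] [? ? e1 e2]] := two x y; first by rewrite e2.
  by rewrite e1.
have tot x y : R x y \/ R y x.
  by have [z [->|->] []] := two x y; [left|right].
exists (fun x y => R x y /\ x <> y); split.
- move=> A /wmin[z Az zmin]; exists z => // x Ax [Rxz]; apply.
  by have [_ ->] := zmin x Ax.
- by move=> x [].
- move=> x y; have [->|nxy] := EM (x = y); first by right; left.
  by have [?|?] := tot x y; [left|right; right]; split => // e; apply: nxy.
- move=> x y z [Rxy nxy] [Ryz nyz].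
  have [|w wA wP] := wmin [set w | w = x \/ w = y \/ w = z]; first by exists x; left.
  have [Rx _] := wP x (or_introl erefl).
  have [Ry _] := wP y (or_intror (or_introl erefl)).
  have [Rz _] := wP z (or_intror (or_intror erefl)).
  case: wA => [ew|[ew|ew]]; subst w.
  + split=> // xz; subst z; apply: nxy; exact: anti.
  + by case: nxy; exact: anti.
  + by case: nyz; exact: anti.
Qed.

(** If some initial segment is not small, take the least such point [t] and a
    map [f] from trees over the segment onto the type.  Ranking a point by the
    largest leaf that is needed to obtain it, and ordering by rank first, makes
    every initial segment part of the image of the trees over a proper initial
    segment of [t]. *)
Lemma exists_small_well_order (T : eqType) : small (@set0 T) ->
  exists2 lt : T -> T -> Prop, strict_well_order lt &
    forall x, small [set y | lt y x].
Proof.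
move=> sm0; have [lt slt] := exists_strict_well_order T.
have [//|nsm] := EM (forall x, small [set y | lt y x]); first by exists lt.
have [minlt irr tri tr] := slt.
have [t nt tmin] := minlt [set t | ~ small [set y | lt y t]] ltac:(exact/existsNP).
have {}tmin u : lt u t -> small [set y | lt y u].
  by move=> ut; apply: contrapT => /tmin.
have /existsNP[f /forallNP fP] := nt.
have {}fP x : exists2 s, leaves_in [set y | lt y t] s & f s = x.
  by apply: contrapT => h; apply: (fP x) => s Ss fs; apply: h; exists s.
have [u0 u0t] : exists u, lt u t.
  apply: contrapT => /forallNP h; apply: nt; apply: small_sub sm0 => y.
  exact: h.
pose le u := [set v | lt v u] `|` [set u].
have le_mono u v : lt u v -> le u `<=` le v.
  by move=> uv w [/= wu|->]; left => //=; exact: tr uv.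
have bnd s : leaves_in [set y | lt y t] s -> exists2 u, lt u t & leaves_in (le u) s.
  elim: s => [x i /= xt|n _|a IHa b IHb /= [/IHa[u ut ua] /IHb[v vt vb]]].
  - by exists x => //; right.
  - by exists u0.
  - have [uv|[uv|vu]] := tri u v.
    + by exists v => //; split=> //; apply: leaves_in_sub ua; exact: le_mono.
    + by exists v => //; rewrite -uv in vb *.
    + by exists u => //; split=> //; apply: leaves_in_sub vb; exact: le_mono.
have /choice[rk rkP] x : exists u, [/\ lt u t, [set f s | s in leaves_in (le u)] x &
    forall v, [set f s | s in leaves_in (le v)] x -> ~ lt v u].
  have [s /bnd[u ut us] fs] := fP x.
  have [|v [vt vx] vmin] := minlt [set u | lt u t /\ [set f s | s in leaves_in (le u)] x].
    by exists u; split => //; exists s.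
  exists v; split=> // w wx wv; apply: (vmin w _ wv); split => //.
  exact: tr wv vt.
exists (fun x y => lt (rk x) (rk y) \/ rk x = rk y /\ lt x y).
  split.
  - move=> A [a Aa].
    have [|_ [z0 Az0 <-] zmin] := minlt [set rk x | x in A]; first by exists (rk a), a.
    have [|z [Az zz0] zmin'] := minlt [set x | A x /\ rk x = rk z0]; first by exists z0.
    exists z => // x Ax; rewrite zz0 => -[|[xz0 xz]].
      by apply: zmin; exists x.
    by apply: (zmin' x).
  - by move=> x [|[_]]; exact: irr.
  - move=> x y; have [?|[e|?]] := tri (rk x) (rk y).
    + by left; left.
    + have [?|[?|?]] := tri x y; [by left; right|by right; left|].
      by right; right; right.
    + by right; right; left.
  - move=> x y z [xy|[exy xy]] [yz|[eyz yz]].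
    + by left; apply: tr yz.
    + by left; rewrite -eyz.
    + by left; rewrite exy.
    + by right; rewrite exy; split => //; apply: tr yz.
move=> x; have [xt _ _] := rkP x.
apply: (@small_sub _ _ [set f s | s in leaves_in (le (rk x))]); last first.
  by apply: small_image; apply: small_add1; exact: tmin.
move=> y /= yx; have [_ [s Ss fs] _] := rkP y; exists s => //.
by case: yx => [/le_mono sub|[<- _]] //; exact: leaves_in_sub Ss.
Qed.

(** Trees without leaves are countable, so this is Cantor's diagonal argument. *)
Lemma small_set0 : small (@set0 (nat -> bool)).
Proof.
move=> f.
pose code := fix code (t : tree (nat -> bool)) : GenTree.tree nat :=
  match t with
  | Leaf _ _ => GenTree.Leaf 0
  | Single n => GenTree.Leaf n
  | Node a b => GenTree.Node 0 [:: code a; code b]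
  end.
pose decode := fix decode (t : GenTree.tree nat) : tree (nat -> bool) :=
  match t with
  | GenTree.Leaf n => Single n
  | GenTree.Node _ [:: a; b] => Node (decode a) (decode b)
  | _ => Single 0
  end.
have codeK t : leaves_in set0 t -> decode (code t) = t.
  by elim: t => //= a IHa b IHb [/IHa -> /IHb ->].
exists (fun n => if unpickle n is Some t then ~~ f (decode t) n else false).
move=> t /codeK tK ft; have := congr1 (fun g => g (pickle (code t))) ft => /=.
by rewrite pickleK tK; case: (f t _).
Qed.

(** * Transfinite recursion *)

Definition upd (T : eqType) S (f : T -> S) x s := fun y => if y == x then s else f y.

(** The requirement at [x] only looks at values up to [x], so that it can be
    met stage by stage. *)
Lemma transfinite_choice (T : eqType) (S : pointedType) (lt : T -> T -> Prop)
    (Phi : T -> (T -> S) -> Prop) : strict_well_order lt ->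
  (forall x f g, (forall y, lt y x \/ y = x -> f y = g y) -> Phi x f -> Phi x g) ->
  (forall x f, (forall y, lt y x -> Phi y f) -> exists s, Phi x (upd f x s)) ->
  exists f, forall x, Phi x f.
Proof.
move=> [minlt irr tri tr] loc step.
have wf : well_founded lt.
  move=> x; apply: contrapT => nAx.
  have [|z nAz zmin] := minlt [set x | ~ Acc lt x]; first by exists x.
  by apply: nAz; constructor => y yz; apply: contrapT => /zmin.
pose body x (rec : forall y, lt y x -> S) : S :=
  get [set s | Phi x (fun y => if pselect (lt y x) is left h then rec y h else s)].
pose F := Fix wf (fun=> S) body.
have FE x : F x = body x (fun y _ => F y).
  rewrite /F Fix_eq// => {}x f g fg; congr body.
  by apply/functional_extensionality_dep => y; apply/funext => h.
exists F; apply: (well_founded_ind wf) => x IH.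
have [s sP] := step x F IH.
have /(xgetPex point) : exists s, Phi x (fun y => if pselect (lt y x) is left _ then F y else s).
  exists s; apply: loc sP => y; rewrite /upd.
  case: eqP => [->|nyx]; first by case: pselect => // h; case: (irr x h).
  by case=> // yx; case: pselect.
rewrite -[xget _ _]/(body x (fun y _ => F y)) -FE; apply: loc => y.
by case: pselect => // nyx [yx|->//]; case: nyx.
Qed.

(** * Boolean terms *)

Section evaluation.
Variable T : Type.
Implicit Type G : T -> nat -> nat -> bool.

(** A tree is a Boolean term over generators [G x i]: leaves are generators,
    numbers are singletons, and a node is the complement of an intersection. *)
Fixpoint eval G (t : tree T) (n : nat) : bool :=
  match t with
  | Leaf x i => G x i n
  | Single m => n == m
  | Node a b => ~~ (eval G a n && eval G b n)
  end.

Lemma eval_local (S : set T) G G' t : (forall y, S y -> G y = G' y) ->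
  leaves_in S t -> eval G t = eval G' t.
Proof.
move=> GG'; elim: t => //= [x i /GG' ->//|a IHa b IHb [/IHa + /IHb +]].
by move=> ea eb; apply/funext => n; rewrite ea eb.
Qed.

Definition tnot (a : tree T) := Node a a.
Definition tand (a b : tree T) := tnot (Node a b).
Definition tor (a b : tree T) := Node (tnot a) (tnot b).
Definition tbot : tree T := tand (Single 0) (tnot (Single 0)).

Lemma eval_not G a n : eval G (tnot a) n = ~~ eval G a n.
Proof. by rewrite /= andbb. Qed.
Lemma eval_and G a b n : eval G (tand a b) n = eval G a n && eval G b n.
Proof. by rewrite /= andbb negbK. Qed.
Lemma eval_or G a b n : eval G (tor a b) n = eval G a n || eval G b n.
Proof. by rewrite /= !andbb negb_and !negbK. Qed.
Lemma eval_bot G n : eval G tbot n = false.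
Proof. by rewrite /= !andbb negbK andbN. Qed.
End evaluation.
Arguments tbot {T}.

Fixpoint tsubst (T : eqType) (x : T) (c : nat -> tree T) (t : tree T) :=
  match t with
  | Leaf y i => if y == x then c i else t
  | Single _ => t
  | Node a b => Node (tsubst x c a) (tsubst x c b)
  end.

Lemma leaves_in_subst (T : eqType) (S : set T) x c t :
  (forall i, leaves_in S (c i)) -> leaves_in (S `|` [set x]) t ->
  leaves_in S (tsubst x c t).
Proof.
move=> Sc; elim: t => //= [y i|a IHa b IHb [/IHa ? /IHb ?]] //.
by case: eqP => // nyx [].
Qed.

Lemma eval_subst (T : eqType) G G' (x : T) c n t :
  (forall i, eval G (c i) n = G' x i n) -> (forall y, y <> x -> G y = G' y) ->
  eval G (tsubst x c t) n = eval G' t n.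
Proof.
move=> cG GG'; elim: t => //= [y i|a -> b ->//].
by case: eqP => [->|/GG' <-].
Qed.

(** * Almost disjoint sets of integers *)

Definition infinite (M : nat -> bool) := forall n, exists2 m, n <= m & M m.

Lemma infinite_enum M : infinite M ->
  exists2 e : nat -> nat, {homo e : m n / m < n} & forall n, M (e n).
Proof.
move=> infM; have /choice[g gP] : forall n, exists m, n <= m /\ M m.
  by move=> n; have [m nm Mm] := infM n; exists m.
pose e := fix e n := if n is n'.+1 then g (e n').+1 else g 0.
exists e; last by case=> [|n] /=; [have [] := gP 0|have [] := gP (e n).+1].
by apply: homo_ltn => [|n]; [exact: ltn_trans|have [] := gP (e n).+1].
Qed.

Lemma infinite_range (g : nat -> nat) : injective g ->
  infinite (fun n => `[< exists i, g i = n >]).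
Proof.
move=> ginj n; apply: contrapT => h.
have lt k : g k < n.
  by rewrite ltnNge; apply/negP => nk; apply: h; exists (g k) => //; apply/asboolP; exists k.
have inj : injective (fun k : 'I_n.+1 => Ordinal (lt k)).
  by move=> i j /(congr1 val) /= /ginj /val_inj.
by have := leq_card _ inj; rewrite !card_ord ltnn.
Qed.

(** The codes of the finite initial words of [r]: a branch of the binary tree. *)
Definition branch (r : nat -> bool) (m : nat) : bool :=
  if pickle_inv m is Some s then s == mkseq r (size s) else false.

Lemma branch_infinite r : infinite (branch r).
Proof.
have inj : injective (fun k => pickle (mkseq r k)).
  by move=> i j /(pcan_inj pickleK) /(congr1 size); rewrite !size_mkseq.
move=> n; have [m nm /asboolP[k km]] := infinite_range inj n.
exists m; rewrite // -km.
by rewrite /branch pickleK_inv size_mkseq eqxx.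
Qed.

Lemma branch_almost_disjoint r r' : r <> r' ->
  exists l : seq nat, forall m, branch r m -> branch r' m -> m \in l.
Proof.
move=> rr'; have [n /eqP rn] : exists n, r n <> r' n.
  by apply: contrapT => /forallNP h; apply: rr'; apply/funext => n; apply: contrapT => /h.
exists [seq pickle (mkseq r k) | k <- iota 0 n.+1] => m; rewrite /branch.
case um: (pickle_inv m) => [s|//] /eqP sr /eqP sr'.
apply/mapP; exists (size s); last first.
  by rewrite -sr; have := @pickle_invK (seq bool) m; rewrite um.
rewrite mem_iota /= add0n ltnS leqNgt; apply/negP => ns.
by move: rn; rewrite -(nth_mkseq false r ns) -(nth_mkseq false r' ns) -sr -sr' eqxx.
Qed.

(** One sequence of bits holds countably many, so that a stage can encode a
    whole construction task. *)
Definition slice (x : nat -> bool) (c : nat) : nat -> bool := fun n => x (pickle (c, n)).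

Lemma slices_onto (g : nat -> nat -> bool) : exists x, forall c, slice x c = g c.
Proof.
exists (fun m => if unpickle m is Some cn then g cn.1 cn.2 else false) => c.
by apply/funext => n; rewrite /slice pickleK.
Qed.

(** * One stage of the construction *)

Definition unionover (J : nat -> bool) (B : nat -> nat -> nat -> bool) (i n : nat) :=
  `[< exists2 k, J k & B k i n >].

Definition disjoint_family (B : nat -> nat -> nat -> bool) :=
  forall k k' i i' n, B k i n -> B k' i' n -> k = k'.

(** At stage [x], the members of the algebra are the terms over the earlier
    stages.  [Pr v] is the subset of [M v] that must not become a trace, and
    the blocks [B k] with pieces [B k i] are those treated at this stage. *)
Section step.
Variables (lt : (nat -> bool) -> (nat -> bool) -> Prop) (x : nat -> bool).
Hypothesis smallx : small [set y | lt y x].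
Let T := nat -> bool.
Let S := [set y | lt y x].
Let cS := S `|` [set x].
Variables (G : T -> nat -> nat -> bool) (Pr : T -> nat -> bool) (M : T -> nat -> bool).
Variable B : nat -> nat -> nat -> bool.
Hypothesis fresh : forall v, S v -> infinite (M v) -> forall t, leaves_in S t ->
  exists2 n, M v n & eval G t n <> Pr v n.
Hypothesis BG : forall k i, exists2 t, leaves_in S t & B k i = eval G t.
Hypothesis Bdisj : disjoint_family B.

(** Traces of terms over earlier stages on [M x] do not exhaust the subsets of
    [M x], by smallness. *)
Lemma new_witness : exists P, infinite (M x) -> forall t, leaves_in S t ->
  exists2 n, M x n & eval G t n <> P n.
Proof.
have [/infinite_enum[e emono Me]|] := EM (infinite (M x)); last by exists (fun=> true).
have [p pP] := smallx (fun t j => eval G t (e j)).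
exists (fun n => `[< exists2 j, e j = n & p j >]) => _ t St.
apply: contrapT => h; apply: (pP t St); apply/funext => j; apply: contrapT => nE.
apply: h; exists (e j) => // Ej; apply: nE; rewrite Ej.
apply/asboolP/idP => [[j' ejj' pj']|pj]; last by exists j.
suff -> : j = j' by [].
by have [/emono|/emono|//] := ltngtP j j'; rewrite ejj' ltnn.
Qed.

(** Some branch is harmless.  Otherwise smallness yields two branches which
    realise the same forbidden trace by the same term.  Replacing in this term
    the new unions by the unions over the finitely many common nodes gives an
    old term; at each point its value is the value of the new term for one of
    the two branches, so that the forbidden trace was realised before. *)
Lemma new_generator P : (infinite (M x) -> forall t, leaves_in S t ->
    exists2 n, M x n & eval G t n <> P n) ->
  exists2 J, infinite J & forall v, cS v -> infinite (M v) ->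
    forall t, leaves_in cS t ->
    exists2 n, M v n & eval (upd G x (unionover J B)) t n <> upd Pr x P v n.
Proof.
move=> Pfresh; apply: contrapT => nJ.
have /choice[w wP] (r : T) : exists vt : T * tree T,
    [/\ cS vt.1, infinite (M vt.1), leaves_in cS vt.2 & forall n, M vt.1 n ->
      eval (upd G x (unionover (branch r) B)) vt.2 n = upd Pr x P vt.1 n].
  apply: contrapT => h; apply: nJ; exists (branch r); first exact: branch_infinite.
  move=> v cv iv t ct; apply: contrapT => h'; apply: h; exists (v, t); split=> //= n Mn.
  by apply: contrapT => nE; apply: h'; exists n.
have sm : small cS by apply: small_add1.
pose F (s : tree T) : T :=
  if s is Node (Leaf v _) t then get [set r | w r = (v, t)] else point.
have [r0 r0P] := sm F.
have [v0 t0 iv0 ct0] := wP r0.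
have : F (Node (Leaf (w r0).1 0) (w r0).2) <> r0 by exact: r0P.
set r1 := F _ => r10.
have wr10 : w r1 = w r0.
  have : [set r | w r = ((w r0).1, (w r0).2)] r0 by exact: surjective_pairing.
  by move=> /(xgetI point) /= ->; rewrite -surjective_pairing.
have [l lP] := branch_almost_disjoint r10.
have [_ _ _] := wP r1; rewrite wr10.
move: (w r0) v0 t0 iv0 ct0 => [v t] /= cv iv ct E0 E1.
have /choice[b bP] : forall k, exists b, forall i, leaves_in S (b i) /\ B k i = eval G (b i).
  move=> k; have /choice[b bP] : forall i, exists s, leaves_in S s /\ B k i = eval G s.
    by move=> i; have [s Ss Bs] := BG k i; exists s.
  by exists b.
pose C K i := foldr (fun k a => tor (b k i) a) tbot K.
have CS K i : leaves_in S (C K i).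
  by elim: K => //= k K IH; have [] := bP k i.
have CE K i n : eval G (C K i) n = has (fun k => B k i n) K.
  elim: K => [|k K IH]; first exact: eval_bot.
  by rewrite [C _ _]/= eval_or IH /=; have [_ ->] := bP k i.
pose K := [seq k <- l | branch r0 k && branch r1 k].
have KP k : (k \in K) = branch r0 k && branch r1 k.
  rewrite mem_filter; apply/andP/idP => [[]//|rk]; split=> //.
  by case/andP: rk => k0 k1; exact: lP.
have CU i n : has (fun k => B k i n) K -> unionover (branch r0) B i n /\
    unionover (branch r1) B i n.
  case/hasP => k; rewrite KP => /andP[k0 k1] Bk.
  by split; apply/asboolP; exists k.
have side n : eval G (tsubst x (C K) t) n = upd Pr x P v n \/ ~ M v n.
  have [Mn|] := EM (M v n); last by right.
  left.
  have [[i [i' [u0 u1]]]|nu] := EM (exists i i',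
     unionover (branch r0) B i n /\ unionover (branch r1) B i' n).
    (* At a point of both unions the block is common to both branches, so that
       the first union and the union over the common nodes agree. *)
    rewrite -E0//; apply: eval_subst => [j|y /eqP yx]; last by rewrite /upd (negbTE yx).
    rewrite CE /upd eqxx; apply/idP/idP => [/CU[]//|/asboolP[k rk Bk]].
    move: u0 u1 => /asboolP[k0 k0r Bk0] /asboolP[k1 k1r Bk1].
    have ? := Bdisj Bk0 Bk1; have ? := Bdisj Bk0 Bk; subst k1 k0.
    by apply/hasP; exists k => //; rewrite KP rk.
  (* Elsewhere the common nodes contribute nothing; compare with a union that
     does not contain the point. *)
  have noC j : has (fun k => B k j n) K = false.
    apply/negP => /CU[u0 u1]; apply: nu; by exists j, j.
  have [[i u0]|nu0] := EM (exists i, unionover (branch r0) B i n).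
    rewrite -E1//; apply: eval_subst => [j|y /eqP yx]; last by rewrite /upd (negbTE yx).
    rewrite CE /upd eqxx noC; apply/esym/negP => u1; apply: nu; by exists i, j.
  rewrite -E0//; apply: eval_subst => [j|y /eqP yx]; last by rewrite /upd (negbTE yx).
  rewrite CE /upd eqxx noC; apply/esym/negP => u0; apply: nu0; by exists j.
have St' : leaves_in S (tsubst x (C K) t) by apply: leaves_in_subst.
have [n Mn] : exists2 n, M v n & eval G (tsubst x (C K) t) n <> upd Pr x P v n.
  rewrite /upd; case: eqP => [vx|nvx].
    by rewrite vx in iv *; exact: Pfresh.
  by case: cv => // Sv; exact: fresh.
by case: (side n).
Qed.
End step.

(** * The algebra *)

Section bounded.
Variables (T : Type) (lt : T -> T -> Prop).
Hypothesis slt : strict_well_order lt.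
Let cseg y := [set z | lt z y] `|` [set y].

Lemma cseg_mono u v : lt u v -> cseg u `<=` cseg v.
Proof. by case: slt => _ _ _ tr uv w [/= wu|->]; left => //=; exact: tr uv. Qed.

Lemma leaves_bounded x v t : lt v x -> leaves_in [set y | lt y x] t ->
  exists y, [/\ lt y x, cseg y v & leaves_in (cseg y) t].
Proof.
move=> vx; have [_ _ tri tr] := slt.
elim: t => [y i /= yx|n _|a IHa b IHb /= [/IHa[y [yx vy ya]] /IHb[z [zx vz zb]]]].
- have [vy|[<-|yv]] := tri v y.
  + by exists y; split => //; [left|right].
  + by exists v; split => //; right.
  + by exists v; split => //; [right|left].
- by exists v; split => //; right.
- have [yz|[yz|zy]] := tri y z.
  + by exists z; split=> //; split=> //; apply: leaves_in_sub ya; exact: cseg_mono.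
  + by exists z; split=> //; split=> //; rewrite -yz in zb *.
  + by exists y; split=> //; split=> //; apply: leaves_in_sub zb; exact: cseg_mono.
Qed.
End bounded.

Section unbounded.
Variable lt : (nat -> bool) -> (nat -> bool) -> Prop.
Hypothesis slt : strict_well_order lt.
Hypothesis sm : forall x, small [set y | lt y x].

(** A diagonal argument as in Koenig's theorem: otherwise the segments below
    the [w n] cover everything, while each of them misses some value of the
    n-th slice. *)
Lemma countable_bounded (w : nat -> nat -> bool) : exists x, forall n, lt (w n) x.
Proof.
have [minlt irr tri tr] := slt.
apply: contrapT => /forallNP h.
have /choice[r rP] n : exists r, forall x, lt x (w n) \/ x = w n -> slice x n <> r.
  have [r rP] := small_add1 (w n) (sm (w n))
    (fun t => if t is Leaf x _ then slice x n else point).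
  exists r => x xw; apply: (rP (Leaf x 0)) => /=.
  by case: xw; [left|right].
have [x xP] := slices_onto r.
apply: (h x) => n; have [//|xw] := tri (w n) x.
by case: (rP n x); [case: xw => [->|]; [right|left]|exact: xP].
Qed.

(** Slice 0 is left free for this purpose: the codes up to [x0] do not use all
    its values. *)
Lemma late_code (g : nat -> nat -> bool) x0 :
  exists2 x, lt x0 x & forall c, slice x c.+1 = g c.
Proof.
have [minlt irr tri tr] := slt.
have [r rP] := small_add1 x0 (sm x0) (fun t => if t is Leaf x _ then slice x 0 else point).
have [x xP] := slices_onto (fun c => if c is c'.+1 then g c' else r).
exists x; last by move=> c; rewrite xP.
have [//|xx] := tri x0 x; case: (rP (Leaf x 0)); last exact: xP.
by case: xx => [->|]; [right|left].
Qed.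
End unbounded.

(** Stage [x] reads the set in slice 1 of [x] and the pieces in the later
    slices.  It treats the pieces only if they are terms over earlier stages,
    which happens for some [x], since countably many terms are bounded and
    codes occur arbitrarily late. *)
Theorem haydon_algebra : exists G : (nat -> bool) -> nat -> nat -> bool,
  (forall M, infinite M -> exists P : nat -> bool, forall t, exists2 n, M n & eval G t n <> P n) /\
  (forall B, (forall k i, exists t, B k i = eval G t) -> disjoint_family B ->
     exists2 J, infinite J & forall i, exists t, unionover J B i = eval G t).
Proof.
pose T := (nat -> bool) : Type.
have [lt slt sm] : exists2 lt : T -> T -> Prop, strict_well_order lt &
    forall x, small [set y | lt y x] := exists_small_well_order small_set0.
have [minlt irr tri tr] := slt.
pose cseg y := [set z | lt z y] `|` [set y].
pose M (x : T) := slice x 1.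
pose B (x : T) (k i : nat) := slice x (pickle (k, i)).+2.
pose Phi x (f : T -> (nat -> T) * T) :=
  (forall v, cseg x v -> infinite (M v) -> forall t, leaves_in (cseg x) t ->
     exists2 n, M v n & eval (fst \o f) t n <> (f v).2 n) /\
  ((forall k i, exists2 t, leaves_in [set y | lt y x] t & B x k i = eval (fst \o f) t) ->
   disjoint_family (B x) -> exists2 J, infinite J & (f x).1 = unionover J (B x)).
have [|x f IH|f fP] := transfinite_choice (Phi := Phi) slt.
- move=> x f g fg [f1 f2].
  have fge t : leaves_in (cseg x) t -> eval (fst \o f) t = eval (fst \o g) t.
    by apply: eval_local => y xy; rewrite /= fg.
  split.
    move=> v cv iv t ct; have [n Mn nE] := f1 v cv iv t ct.
    by exists n => //; rewrite -fge// -fg.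
  move=> BG Bd; rewrite -fg; last by right.
  apply: f2 => // k i; have [t St Bt] := BG k i; exists t => //.
  by rewrite fge//; apply: leaves_in_sub St; left.
- have fresh v : lt v x -> infinite (M v) -> forall t, leaves_in [set y | lt y x] t ->
      exists2 n, M v n & eval (fst \o f) t n <> (snd \o f) v n.
    move=> vx iv t St; have [y [yx vy ty]] := leaves_bounded slt vx St.
    by have [h _] := IH y yx; apply: h.
  have [P PP] := new_witness (sm x) (fst \o f) M.
  pose valid := (forall k i, exists2 t, leaves_in [set y | lt y x] t &
    B x k i = eval (fst \o f) t) /\ disjoint_family (B x).
  (* Blocks that are not admissible at this stage are replaced by empty ones. *)
  pose B' := if pselect valid then B x else fun _ _ _ => false.
  have B'G k i : exists2 t, leaves_in [set y | lt y x] t & B' k i = eval (fst \o f) t.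
    rewrite /B'; case: (pselect valid) => /= [[h _]|_]; first exact: h.
    exists tbot => //; apply/funext => n; by rewrite eval_bot.
  have B'd : disjoint_family B'.
    by rewrite /B'; case: (pselect valid) => /= [[_ h]|_]; [exact: h|move=> k k' i i' n].
  have [J infJ JP] := @new_generator lt x (sm x) (fst \o f) (snd \o f) M B' fresh B'G B'd P PP.
  exists (unionover J B', P); split.
    move=> v cv iv t ct; have [n Mn nE] := JP v cv iv t ct; exists n => //.
    suff <- : upd (fst \o f) x (unionover J B') = fst \o upd f x (unionover J B', P).
      by move: nE; rewrite /upd; case: eqP.
    by apply/funext => y; rewrite /upd/=; case: eqP.
  move=> BG Bd; exists J => //; rewrite /upd eqxx /= /B'; case: pselect => //= -[].
  split=> // k i; have [t St Bt] := BG k i; exists t => //.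
  rewrite Bt; apply: eval_local St => y /= yx; rewrite /upd/=.
  by case: eqP => // yx'; case: (irr x); rewrite -{1}yx'.
exists (fst \o f); split.
  move=> M0 infM; have [x xP] := slices_onto (fun=> M0).
  have Mx : M x = M0 by exact: xP.
  exists (f x).2 => t.
  have [y xy ty] : exists2 y, cseg y x & leaves_in (cseg y) t.
    have [z zP] := countable_bounded slt sm (fun=> x).
    elim: t => [y i|n|a [u ux ua] b [v vx vb]].
    - have [xy|[xy|yx]] := tri x y.
      + by exists y; [left|right].
      + by exists y; [right|right].
      + by exists x; [right|left].
    - by exists x => //; right.
    - have [uv|[uv|vu]] := tri u v.
      + by exists v => //; split=> //; apply: leaves_in_sub ua; exact: cseg_mono.
      + by exists v => //; rewrite -uv in vb *.
      + by exists u => //; split=> //; apply: leaves_in_sub vb; exact: cseg_mono.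
  have [h _] := fP y; have := h x xy; rewrite Mx; exact.
move=> B0 B0G B0d.
have /choice[b bP] (ki : nat * nat) : exists t, B0 ki.1 ki.2 = eval (fst \o f) t by exact: B0G.
have leafb t : exists x, leaves_in [set y | lt y x] t.
  elim: t => [y i|n|a [u ua] b' [v vb]].
  - by have [z zP] := countable_bounded slt sm (fun=> y); exists z; exact: (zP 0).
  - by exists point.
  - have [z zP] := countable_bounded slt sm (fun n => if n is 0 then u else v).
    exists z; split; [apply: leaves_in_sub ua|apply: leaves_in_sub vb] => y /= yy.
    + exact: tr yy (zP 0).
    + exact: tr yy (zP 1).
have /choice[w wP] n : exists x, leaves_in [set y | lt y x]
    (if unpickle n is Some ki then b ki else Single 0) by exact: leafb.
have [x0 x0P] := countable_bounded slt sm w.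
have [x xx0 xP] := late_code slt sm
  (fun c => if c is c'.+1 then if unpickle c' is Some ki then B0 ki.1 ki.2 else point else point) x0.
have Bx : B x = B0.
  by apply/funext => k; apply/funext => i; rewrite /B xP pickleK.
have [_ h] := fP x; rewrite Bx in h.
have [k i|//|J infJ fJ] := h.
  exists (b (k, i)); last exact: (bP (k, i)).
  have := wP (pickle (k, i)); rewrite pickleK; apply: leaves_in_sub => y /= yw.
  exact: (tr _ _ _ (tr _ _ _ yw (x0P _)) xx0).
exists J => // i; exists (Leaf x i); apply/funext => n.
by rewrite -fJ.
Qed.

Record haydon (A : set (nat -> bool)) : Prop := Haydon {
  alg_not : forall P, A P -> A (fun n => ~~ P n);
  alg_and : forall P Q, A P -> A Q -> A (fun n => P n && Q n);
  alg_one : forall m, A (pred1 m);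
  alg_traceless : forall M, infinite M ->
    exists P : nat -> bool, forall Q, A Q -> exists2 n, M n & Q n <> P n;
  alg_subunion : forall B, (forall k i, A (B k i)) -> disjoint_family B ->
    exists2 J, infinite J & forall i, A (unionover J B i) }.

Theorem exists_haydon : exists A, haydon A.
Proof.
have [G [Gt Gs]] := haydon_algebra.
exists [set P | exists t, P = eval G t]; split.
- move=> _ [t ->]; exists (tnot t); apply/funext => n; by rewrite eval_not.
- move=> _ _ [t ->] [u ->]; exists (tand t u); apply/funext => n; by rewrite eval_and.
- by move=> m; exists (Single m).
- by move=> M /Gt[P MP]; exists P => _ [t ->].
- exact: Gs.
Qed.

Local Open Scope ring_scope.

(** * The real and the complex field together *)

Section scalars.
Variables (R : realType) (s : scalars).
Local Notation K := (scalar_field R s).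

(** Estimates are made in the real numbers: [emb] embeds them into the scalars,
    [rp] is the real part and [nrm] the real-valued absolute value. *)
Definition emb : R -> K :=
  match s return R -> scalar_field R s with
  | RealScalars => fun r => r
  | ComplexScalars => fun r => (r%:C)%C
  end.

Definition rp : K -> R :=
  match s return scalar_field R s -> R with
  | RealScalars => fun z => z
  | ComplexScalars => fun z => complex.Re z
  end.

Definition nrm (z : K) : R := rp `|z|.
End scalars.
Arguments emb {R s}.

Section scalar_lemmas.
Variables (R : realType) (s : scalars).
Local Notation K := (scalar_field R s).
Implicit Types (z w : K) (a b : R).

Lemma embD a b : emb (a + b) = emb a + emb b :> K.
Proof. by case: s => //=; rewrite rmorphD. Qed.
Lemma embN a : emb (- a) = - emb a :> K.
Proof. by case: s => //=; rewrite rmorphN. Qed.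
Lemma embB a b : emb (a - b) = emb a - emb b :> K.
Proof. by rewrite embD embN. Qed.
Lemma embM a b : emb (a * b) = emb a * emb b :> K.
Proof. by case: s => //=; rewrite rmorphM. Qed.
Lemma emb0 : emb 0 = 0 :> K. Proof. by case: s. Qed.
Lemma emb1 : emb 1 = 1 :> K. Proof. by case: s. Qed.
Lemma ler_emb a b : (emb a <= emb b :> K) = (a <= b).
Proof. by case: s => //=; rewrite lecR. Qed.
Lemma ltr_emb a b : (emb a < emb b :> K) = (a < b).
Proof. by case: s => //=; rewrite ltcR. Qed.
Lemma rpD z w : rp (z + w) = rp z + rp w.
Proof. by case: s z w => //= -[a b] [c d]. Qed.
Lemma rpN z : rp (- z) = - rp z.
Proof. by case: s z => //= -[a b]. Qed.
Lemma rpB z w : rp (z - w) = rp z - rp w.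
Proof. by rewrite rpD rpN. Qed.
Lemma rp_emb a : rp (emb a : K) = a.
Proof. by case: s. Qed.
Lemma rpZ a z : rp (emb a * z) = a * rp z.
Proof. by case: s z => //= -[b c] /=; rewrite mul0r subr0. Qed.
Lemma ge0_emb z : 0 <= z -> z = emb (rp z).
Proof. by case: s z => //= -[b c]; rewrite lecE /= => /andP[/eqP -> _]. Qed.
Lemma norm_emb z : `|z| = emb (nrm z).
Proof. exact/ge0_emb/normr_ge0. Qed.
Lemma nrm_ge0 z : 0 <= nrm z.
Proof. by rewrite -(ler_emb 0) -norm_emb emb0. Qed.
Lemma nrm0 : nrm (0 : K) = 0.
Proof. by rewrite /nrm normr0 -emb0 rp_emb. Qed.
Lemma nrm1 : nrm (1 : K) = 1.
Proof. by rewrite /nrm normr1 -emb1 rp_emb. Qed.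
Lemma nrmN z : nrm (- z) = nrm z. Proof. by rewrite /nrm normrN. Qed.
Lemma nrmC z w : nrm (z - w) = nrm (w - z). Proof. by rewrite /nrm distrC. Qed.
Lemma nrmD z w : nrm (z + w) <= nrm z + nrm w.
Proof. by rewrite -ler_emb embD -!norm_emb ler_normD. Qed.
Lemma nrmB z w : nrm (z - w) <= nrm z + nrm w.
Proof. by rewrite -(nrmN w) nrmD. Qed.
Lemma nrmM z w : nrm (z * w) = nrm z * nrm w.
Proof.
have : emb (nrm (z * w)) = emb (nrm z * nrm w) :> K.
  by rewrite embM -!norm_emb normrM.
by move=> /(congr1 (@rp R s)); rewrite !rp_emb.
Qed.
Lemma nrm_emb a : nrm (emb a : K) = `|a|.
Proof.
rewrite /nrm; case: s => //=.
by rewrite expr0n/= addr0 sqrtr_sqr.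
Qed.
Lemma nrm_eq0 z : nrm z = 0 -> z = 0.
Proof. by move=> z0; apply/eqP; rewrite -normr_eq0 norm_emb z0 emb0. Qed.
Lemma norm_le_emb z a : (`|z| <= emb a) = (nrm z <= a).
Proof. by rewrite norm_emb ler_emb. Qed.
Lemma norm_lt_emb z a : (`|z| < emb a) = (nrm z < a).
Proof. by rewrite norm_emb ltr_emb. Qed.
Lemma rp_le_nrm z : rp z <= nrm z.
Proof.
rewrite /nrm; case: s z => /= [z|[a b]] /=; first exact: ler_norm.
by apply: (le_trans (ler_norm a)); rewrite -sqrtr_sqr ler_wsqrtr// lerDl sqr_ge0.
Qed.
Lemma rp_ge_nrm z : - nrm z <= rp z.
Proof. by rewrite lerNl -rpN -nrmN rp_le_nrm. Qed.
Lemma nrm_parallelogram z w :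
  nrm (z + w) ^+ 2 + nrm (z - w) ^+ 2 = 2 * nrm z ^+ 2 + 2 * nrm w ^+ 2.
Proof.
rewrite /nrm; case: s z w => /= [z w|[a b] [c d]] /=.
  rewrite !real_normK ?num_real//; ring.
rewrite !sqr_sqrtr ?addr_ge0 ?sqr_ge0//; ring.
Qed.
Lemma rotation z : exists2 u : K, nrm u = 1 & u * z = emb (nrm z).
Proof.
have [->|z0] := eqVneq z 0; first by exists 1; rewrite ?nrm1// mulr0 nrm0 emb0.
exists (`|z| / z); last by rewrite divfK// norm_emb.
suff : emb (nrm (`|z| / z)) = emb 1 :> K by move/(congr1 (@rp R s)); rewrite !rp_emb.
by rewrite -norm_emb normrM normfV normr_id divff ?normr_eq0// emb1.
Qed.

End scalar_lemmas.

(** * Finite nets of the unit disc *)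

Section net.
Variable R : realType.

Lemma real_net (e : R) : 0 < e ->
  exists g : seq R, forall x, `|x| <= 1 -> exists2 y, y \in g & `|x - y| <= e.
Proof.
move=> e0; have cov n (x : R) : 0 <= x <= n%:R * e ->
    exists2 i, (i <= n)%N & `|x - i%:R * e| <= e.
  elim: n => [|n IH] /andP[x0 xn].
    exists 0%N => //; rewrite mul0r in xn *; rewrite subr0.
    by rewrite (_ : x = 0) ?normr0 ?ltW//; apply/eqP; rewrite eq_le xn.
  have [xn'|xn'] := leP x (n%:R * e).
    by have [|i /leqW ? ?] := IH; [rewrite x0|exists i].
  exists n => //; rewrite -natr1 mulrDl mul1r in xn.
  by rewrite ger0_norm; lra.
pose n := Num.bound (2 / e).
have ne : 2 <= n%:R * e.
  by rewrite -ler_pdivrMr// ltW// archi_boundP// divr_ge0// ltW.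
exists [seq i%:R * e - 1 | i <- iota 0 n.+1] => x x1.
have [|i ni xi] := cov n (x + 1); first by move: x1; rewrite ler_norml => ?; lra.
exists (i%:R * e - 1); last by rewrite opprB addrA.
by apply/mapP; exists i => //; rewrite mem_iota.
Qed.

Lemma disc_net (s : scalars) (e : R) : 0 < e ->
  exists g : seq (scalar_field R s), (forall w, w \in g -> nrm w <= 1) /\
    forall z : scalar_field R s, nrm z <= 1 -> exists2 w, w \in g & nrm (z - w) <= e.
Proof.
move=> e0.
have [g gP] : exists g : seq (scalar_field R s),
    forall z, nrm z <= 1 -> exists2 w, w \in g & nrm (z - w) <= e / 2.
  have [|g gP] := @real_net (e / 4); first by lra.
  case: s => /=.
    exists g => z /gP[w wg zw]; exists w => //.
    by rewrite (le_trans zw)//; lra.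
  exists [seq (a +i* b)%C | a <- g, b <- g] => -[a b].
  rewrite /nrm/= => ab1.
  have sq : a ^+ 2 + b ^+ 2 <= 1.
    by rewrite -(@ler_sqrt _ _ 1)// sqrtr1.
  have [|a' a'g aa'] := gP a.
    rewrite -(@expr_le1 _ 2)// real_normK ?num_real//.
    by apply: le_trans sq; rewrite lerDl sqr_ge0.
  have [|b' b'g bb'] := gP b.
    rewrite -(@expr_le1 _ 2)// real_normK ?num_real//.
    by apply: le_trans sq; rewrite lerDr sqr_ge0.
  exists (a' +i* b')%C; first exact: allpairs_f.
  rewrite -(@ler_pXn2r _ 2)// ?nnegrE ?sqrtr_ge0//; last by lra.
  rewrite sqr_sqrtr ?addr_ge0 ?sqr_ge0//.
  rewrite -(real_normK (num_real (a - a'))) -(real_normK (num_real (b - b'))).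
  have := normr_ge0 (a - a'); have := normr_ge0 (b - b').
  by nra.
(* Retracting the net onto the disc at most doubles the distances to points of
   the disc. *)
exists [seq if nrm w <= 1 then w else emb (nrm w)^-1 * w | w <- g]; split.
  move=> _ /mapP[w _ ->]; case: ifPn => //; rewrite -ltNge => w1.
  by rewrite nrmM nrm_emb gtr0_norm ?invr_gt0 ?mulVf//; lra.
move=> z z1; have [w wg zw] := gP z z1.
exists (if nrm w <= 1 then w else emb (nrm w)^-1 * w); first exact: map_f.
case: ifPn => [_|]; first by apply: (le_trans zw); lra.
rewrite -ltNge => w1.
have -> : z - emb (nrm w)^-1 * w = (z - w) + emb (1 - (nrm w)^-1) * w.
  by rewrite embB emb1; ring.
apply: (le_trans (nrmD _ _)); rewrite nrmM nrm_emb.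
have : nrm w <= nrm z + nrm (z - w).
  by apply: le_trans (nrmB _ _); rewrite subKr.
have -> : `|1 - (nrm w)^-1| = 1 - (nrm w)^-1.
  by rewrite ger0_norm// subr_ge0 invf_le1//; lra.
rewrite mulrBl mulVf; last by lra.
lra.
Qed.
End net.

(** * Limits along an ultrafilter *)

Section ultralimit.
Variables (R : realType) (U : set_system nat).
Hypothesis UU : UltraFilter U.
Let FU : ProperFilter U := ultra_proper.

Definition ultra_to (s : scalars) (a : nat -> scalar_field R s) l :=
  forall e : R, 0 < e -> U [set n | nrm (a n - l) < e].

Lemma real_ultra_cvg (a : nat -> R) C : (forall n, `|a n| <= C) ->
  exists l, forall e : R, 0 < e -> U [set n | `|a n - l| < e].
Proof.
move=> aC; pose S := [set x | U [set n | x <= a n]].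
have SC x : S x -> x <= C.
  move=> /filter_ex[n /= xn]; apply: (le_trans xn).
  by have := aC n; rewrite ler_norml => /andP[].
have S0 : S (- C).
  by apply: filterE => n /=; have := aC n; rewrite ler_norml => /andP[].
have supS : has_sup S by split; [exists (- C)|exists C].
exists (sup S) => e e0.
have [x Sx xl] := sup_adherent e0 supS.
have [Se|nSe] := in_ultra_setVsetC [set n | sup S + e <= a n] UU.
  by have := ub_le_sup supS.2 Se; rewrite gerDl leNgt e0.
move: Sx nSe; rewrite /S /= => Sx nSe.
apply: filterS (filterI Sx nSe) => n /= [xn /negP]; rewrite -ltNge => ne.
by rewrite ltr_norml; lra.
Qed.

Lemma ultra_cvg (s : scalars) (a : nat -> scalar_field R s) C :
  (forall n, nrm (a n) <= C) -> exists l, ultra_to a l.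
Proof.
rewrite /ultra_to; case: s a => /= a aC; first exact: (real_ultra_cvg (C := C)).
have Re_le (z : R[i]) : `|complex.Re z| <= @nrm R ComplexScalars z.
  case: z => x y; rewrite /nrm/= -sqrtr_sqr ler_wsqrtr// lerDl sqr_ge0//.
have Im_le (z : R[i]) : `|complex.Im z| <= @nrm R ComplexScalars z.
  case: z => x y; rewrite /nrm/= -sqrtr_sqr ler_wsqrtr// lerDr sqr_ge0//.
have [x xP] : exists l, forall e : R, 0 < e -> U [set n | `|complex.Re (a n) - l| < e].
  by apply: (real_ultra_cvg (C := C)) => n; apply: le_trans (aC n).
have [y yP] : exists l, forall e : R, 0 < e -> U [set n | `|complex.Im (a n) - l| < e].
  by apply: (real_ultra_cvg (C := C)) => n; apply: le_trans (aC n).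
exists (x +i* y)%C => e e0.
have e2 : 0 < e / 2 by lra.
apply: filterS (filterI (xP _ e2) (yP _ e2)) => n /= [].
case: (a n) => b c /= bx cy; rewrite /nrm/=.
rewrite -(@ltr_pXn2r _ 2)// ?nnegrE ?sqrtr_ge0//; last by lra.
rewrite sqr_sqrtr ?addr_ge0 ?sqr_ge0//.
rewrite -(real_normK (num_real (b - x))) -(real_normK (num_real (c - y))).
have := normr_ge0 (b - x); have := normr_ge0 (c - y).
by nra.
Qed.

Definition ulim (s : scalars) (a : nat -> scalar_field R s) := xget 0 (ultra_to a).

Section ulim.
Variable s : scalars.
Implicit Types a b : nat -> scalar_field R s.

Lemma ulimP a C : (forall n, nrm (a n) <= C) -> ultra_to a (ulim a).
Proof. by move=> /ultra_cvg/(xgetPex 0). Qed.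

Lemma ultra_to_unique a l l' : ultra_to a l -> ultra_to a l' -> l = l'.
Proof.
move=> al al'; apply/eqP; rewrite -subr_eq0; apply/eqP/nrm_eq0.
apply: contrapT => /eqP n0.
have e0 : 0 < nrm (l - l') / 2 by rewrite divr_gt0// lt_neqAle eq_sym n0 nrm_ge0.
have [n /= [h1 h2]] : exists n, nrm (a n - l) < nrm (l - l') / 2 /\
    nrm (a n - l') < nrm (l - l') / 2 by exact: filter_ex (filterI (al _ e0) (al' _ e0)).
have : nrm (l - l') <= nrm (a n - l') + nrm (a n - l).
  apply: le_trans (nrmB _ _); by rewrite (_ : _ - _ = l - l')//; ring.
lra.
Qed.

Lemma ulimE a l : ultra_to a l -> ulim a = l.
Proof. by move=> al; apply: ultra_to_unique (al); apply: xgetPex; exists l. Qed.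

Lemma ultra_toD a b l m : ultra_to a l -> ultra_to b m ->
  ultra_to (fun n => a n + b n) (l + m).
Proof.
move=> al bm e e0; have e2 : 0 < e / 2 by lra.
apply: filterS (filterI (al _ e2) (bm _ e2)) => n /= [].
rewrite opprD addrACA; have := nrmD (a n - l) (b n - m); lra.
Qed.

Lemma ultra_toZ a l c : ultra_to a l -> ultra_to (fun n => c * a n) (c * l).
Proof.
move=> al e e0; have e2 : 0 < e / (nrm c + 1).
  by rewrite divr_gt0// ltr_wpDl// nrm_ge0.
apply: filterS (al _ e2) => n /=; rewrite -mulrBr nrmM.
have c1 : 0 < nrm c + 1 by rewrite ltr_wpDl// nrm_ge0.
rewrite ltr_pdivlMr//; have := nrm_ge0 (a n - l); have := nrm_ge0 c; nra.
Qed.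

Lemma ultra_to_le a l C : ultra_to a l -> U [set n | nrm (a n) <= C] -> nrm l <= C.
Proof.
move=> al aC; apply/ler_addgt0Pr => e e0.
have [n /= [h1 h2]] : exists n, nrm (a n - l) < e /\ nrm (a n) <= C
    by exact: filter_ex (filterI (al _ e0) aC).
have : nrm l <= nrm (a n) + nrm (a n - l).
  by apply: le_trans (nrmB _ _); rewrite subKr.
lra.
Qed.
End ulim.
End ultralimit.

(** * Simple functions over the algebra *)

Section simple_functions.
Variable A : set (nat -> bool).
Hypothesis HA : haydon A.

Lemma alg_false : A (fun=> false).
Proof.
have := alg_and HA (alg_one HA 0) (alg_not HA (alg_one HA 0)).
by congr A; apply/funext => n; rewrite andbN.
Qed.

Lemma alg_or P Q : A P -> A Q -> A (fun n => P n || Q n).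
Proof.
move=> AP AQ; have := alg_not HA (alg_and HA (alg_not HA AP) (alg_not HA AQ)).
by congr A; apply/funext => n; rewrite negb_and !negbK.
Qed.

Lemma alg_diff P Q : A P -> A Q -> A (fun n => P n && ~~ Q n).
Proof. by move=> AP AQ; exact: alg_and (alg_not HA AQ). Qed.

Lemma alg_has (Y : Type) (P : Y -> nat -> bool) s : (forall x, A (P x)) ->
  A (fun n => has (fun x => P x n) s).
Proof.
by move=> AP; elim: s => [|x s IH] /=; [exact: alg_false|exact: alg_or].
Qed.

Lemma alg_cst b : A (fun=> b).
Proof. by case: b; [exact: (alg_not HA alg_false)|exact: alg_false]. Qed.

Definition simple (Y : eqType) (f : nat -> Y) :=
  (exists s : seq Y, forall n, f n \in s) /\ forall c, A (fun n => f n == c).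

Lemma simple_preim (Y : eqType) (f : nat -> Y) (p : Y -> bool) :
  simple f -> A (fun n => p (f n)).
Proof.
move=> [[s sf] Af].
have := alg_has s (fun c => alg_and HA (Af c) (alg_cst (p c))).
congr A; apply/funext => n; apply/hasP/idP => [[c _ /andP[/eqP -> //]]|pf].
by exists (f n) => //; rewrite eqxx.
Qed.

(** Arbitrary binary operations are allowed, because only finitely many values
    occur. *)
Lemma simple_comp2 (Y1 Y2 Z : eqType) (phi : Y1 -> Y2 -> Z) f g :
  simple f -> simple g -> simple (fun n => phi (f n) (g n)).
Proof.
move=> sf sg; have [[s fs] Af] := sf; have [[t gt] Ag] := sg; split.
  by exists [seq phi a b | a <- s, b <- t] => n; exact: allpairs_f.
move=> c.
have := alg_has s (fun a => alg_and HA (Af a)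
  (simple_preim (fun b => phi a b == c) sg)).
congr A; apply/funext => n; apply/hasP/idP => [[a _ /andP[/eqP -> //]]|pf].
by exists (f n) => //; rewrite eqxx.
Qed.

Lemma simple_cst (Y : eqType) (c : Y) : simple (fun=> c).
Proof.
by split; [exists [:: c] => n; rewrite inE|move=> d; exact: alg_cst].
Qed.

Lemma simple_comp (Y Z : eqType) (phi : Y -> Z) f :
  simple f -> simple (fun n => phi (f n)).
Proof. by move=> sf; exact: (simple_comp2 (fun y _ => phi y) sf (simple_cst true)). Qed.

Lemma simple_alg P : A P -> simple P.
Proof.
move=> AP; split; first by exists [:: true; false] => n; case: (P n).
by case; [move: AP|have := alg_not HA AP]; congr A; apply/funext => n; case: (P n).
Qed.

Lemma simple_if (Y : eqType) P (f g : nat -> Y) : A P -> simple f -> simple g ->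
  simple (fun n => if P n then f n else g n).
Proof.
move=> /simple_alg sP sf sg.
exact: (simple_comp2 (fun b (yz : Y * Y) => if b then yz.1 else yz.2) sP
  (simple_comp2 pair sf sg)).
Qed.

End simple_functions.

(** * Variation of a functional *)

Section variation.
Variables (R : realType) (s : scalars).
Local Notation K := (scalar_field R s).
Variable A : set (nat -> bool).
Hypothesis HA : haydon A.
Local Notation simple := (simple A).
Implicit Types (h : nat -> K) (g : nat -> R).

(** [L] is defined on all sequences but constrained only at simple ones, which
    avoids a separate type of simple functions. *)
Record functional (C : R) (L : (nat -> K) -> K) : Prop := Functional {
  functD : forall f h, simple f -> simple h -> L (fun n => f n + h n) = L f + L h;
  functZ : forall c f, simple f -> L (fun n => c * f n) = c * L f;
  funct_bound : forall f c, simple f -> (forall n, nrm (f n) <= c) -> nrm (L f) <= C * c }.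

Lemma simple_bounded g : simple g -> exists c, forall n, g n <= c.
Proof.
move=> [[t tg] _].
have {}tg : forall n, g n \in t by [].
have [c cP] : exists c, forall y, y \in t -> y <= c.
  elim: (t) => [|y u [c cP]]; first by exists 0.
  exists (Num.max y c) => z; rewrite inE => /orP[/eqP ->|/cP zc]; rewrite le_max ?lexx//.
  by rewrite zc orbT.
by exists c => n; exact: cP.
Qed.

(** For a nonnegative [g], the integral of [g] against the total variation of
    [L]. *)
Definition variation (L : (nat -> K) -> K) g : R :=
  sup [set nrm (L h) | h in [set h | simple h /\ forall n, nrm (h n) <= g n]].

Section variation_theory.
Variables (C : R) (L : (nat -> K) -> K).
Hypothesis LC : functional C L.

Lemma funct0 : L (fun=> 0) = 0.
Proof.
have := functZ LC 0 (simple_cst HA (0 : K)).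
by rewrite !mul0r.
Qed.

Let supp g : simple g -> (forall n, 0 <= g n) ->
  has_sup [set nrm (L h) | h in [set h | simple h /\ forall n, nrm (h n) <= g n]].
Proof.
move=> sg g0; split.
  exists 0, (fun=> 0); last by rewrite funct0 nrm0.
  by split=> [|n]; [exact: simple_cst|rewrite nrm0].
have [c cP] := simple_bounded sg; exists (C * c) => _ [h [sh hg] <-].
by apply: (funct_bound LC) => // n; exact: le_trans (hg n) (cP n).
Qed.

Lemma le_variation h g : simple g -> (forall n, 0 <= g n) ->
  simple h -> (forall n, nrm (h n) <= g n) -> nrm (L h) <= variation L g.
Proof. by move=> sg g0 sh hg; apply: (ub_le_sup (supp sg g0).2); exists h. Qed.

Lemma variation_le g b : simple g -> (forall n, 0 <= g n) ->
  (forall h, simple h -> (forall n, nrm (h n) <= g n) -> nrm (L h) <= b) ->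
  variation L g <= b.
Proof.
by move=> sg g0 hb; apply: (ge_sup (supp sg g0).1) => _ [h [sh hg] <-]; exact: hb.
Qed.

Lemma variation_ge0 g : simple g -> (forall n, 0 <= g n) -> 0 <= variation L g.
Proof.
move=> sg g0; rewrite -(nrm0 R s) -funct0; apply: le_variation => //.
  exact: simple_cst.
by move=> n; rewrite nrm0.
Qed.

Lemma variation_bound g c : simple g -> (forall n, 0 <= g n <= c) ->
  variation L g <= C * c.
Proof.
move=> sg gc; apply: variation_le => // [n|h sh hg]; first by case/andP: (gc n).
apply: (funct_bound LC) => // n; apply: le_trans (hg n) _; by case/andP: (gc n).
Qed.

Lemma variation_mono g1 g2 : simple g1 -> (forall n, 0 <= g1 n) -> simple g2 ->
  (forall n, g1 n <= g2 n) -> variation L g1 <= variation L g2.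
Proof.
move=> s1 g0 s2 g12; apply: variation_le => // h sh hg.
apply: le_variation => // n; exact: le_trans (g12 n).
Qed.

Lemma simpleM c f : simple f -> simple (fun n => c * f n : K).
Proof. exact: (simple_comp HA ( *%R c)). Qed.

Lemma variation_approx g e : simple g -> (forall n, 0 <= g n) -> 0 < e ->
  exists h, [/\ simple h, forall n, nrm (h n) <= g n, variation L g - e < nrm (L h) &
    L h = emb (nrm (L h))].
Proof.
move=> sg g0 e0; have [_ [h [sh hg] <-] hs] := sup_adherent e0 (supp sg g0).
have [u u1 uL] := rotation (L h).
exists (fun n => u * h n); have uE : L (fun n => u * h n) = emb (nrm (L h)).
  by rewrite (functZ LC).
split; first exact: simpleM.
- by move=> n; rewrite nrmM u1 mul1r.
- by rewrite uE nrm_emb ger0_norm// nrm_ge0.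
- by rewrite uE nrm_emb ger0_norm// nrm_ge0.
Qed.

Lemma simpleD (g1 g2 : nat -> R) : simple g1 -> simple g2 -> simple (fun n => g1 n + g2 n).
Proof. exact: (simple_comp2 HA +%R). Qed.

(** Superadditivity: rotate two functions so that [L] is nonnegative on both,
    and add them.  Subadditivity: split [h] in the proportion [g1 : g2], which
    preserves simplicity. *)
Lemma variationD g1 g2 : simple g1 -> (forall n, 0 <= g1 n) ->
  simple g2 -> (forall n, 0 <= g2 n) ->
  variation L (fun n => g1 n + g2 n) = variation L g1 + variation L g2.
Proof.
move=> s1 g10 s2 g20; have s12 := simpleD s1 s2.
have g120 n : 0 <= g1 n + g2 n by rewrite addr_ge0.
apply/eqP; rewrite eq_le; apply/andP; split.
  apply: variation_le => // h sh hg.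
  (* Where [g1 + g2] vanishes the quotient is 0 and [h] vanishes too. *)
  pose q1 n := g1 n / (g1 n + g2 n).
  have sq1 : simple q1 by exact: (simple_comp2 HA (fun x y => x / (x + y)) s1 s2).
  pose h1 n := emb (q1 n) * h n; pose h2 n := emb (1 - q1 n) * h n.
  have sh1 : simple h1 by exact: (simple_comp2 HA (fun x y => emb x * y) sq1 sh).
  have sh2 : simple h2 by exact: (simple_comp2 HA (fun x y => emb (1 - x) * y) sq1 sh).
  have -> : h = (fun n => h1 n + h2 n).
    by apply/funext => n; rewrite /h1 /h2 -mulrDl -embD addrC subrK emb1 mul1r.
  rewrite (functD LC)//; apply: (le_trans (nrmD _ _)).
  have q01 n : 0 <= q1 n <= 1.
    rewrite /q1 divr_ge0//=.
    have [->|nz] := eqVneq (g1 n + g2 n) 0; first by rewrite invr0 mulr0.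
    by rewrite ler_pdivrMr ?mul1r ?lerDl// lt0r nz g120.
  apply: lerD; apply: le_variation => // n; rewrite nrmM nrm_emb ger0_norm.
  - have [z|nz] := eqVneq (g1 n + g2 n) 0.
      by move: (hg n); rewrite /q1 z invr0 mulr0 mul0r.
    rewrite /q1 mulrAC ler_pdivrMr ?lt0r ?nz ?g120//.
    by rewrite ler_wpM2l.
  - by case/andP: (q01 n).
  - have [z|nz] := eqVneq (g1 n + g2 n) 0.
      have -> : nrm (h n) = 0 by apply/eqP; rewrite eq_le nrm_ge0 andbT -z.
      by rewrite mulr0.
    have -> : 1 - q1 n = g2 n / (g1 n + g2 n).
      by rewrite /q1 -{1}(divff nz) -mulrBl addrC addKr.
    rewrite mulrAC ler_pdivrMr ?lt0r ?nz ?g120//.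
    by rewrite ler_wpM2l.
  - by rewrite subr_ge0; case/andP: (q01 n).
apply/ler_addgt0Pr => e e0; have e2 : 0 < e / 2 by lra.
have [h1 [sh1 hg1 lt1 E1]] := variation_approx s1 g10 e2.
have [h2 [sh2 hg2 lt2 E2]] := variation_approx s2 g20 e2.
have : nrm (L (fun n => h1 n + h2 n)) <= variation L (fun n => g1 n + g2 n).
  apply: le_variation => //; first exact: (simple_comp2 HA +%R).
  by move=> n; apply: (le_trans (nrmD _ _)); rewrite lerD.
rewrite (functD LC)// E1 E2 -embD nrm_emb ger0_norm ?addr_ge0 ?nrm_ge0//.
lra.
Qed.

Lemma variationZ_ge g t : simple g -> (forall n, 0 <= g n) -> 0 < t ->
  t * variation L g <= variation L (fun n => t * g n).
Proof.
move=> sg g0 t0; rewrite -ler_pdivlMl//; apply: variation_le => // h sh hg.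
rewrite ler_pdivlMl//.
have -> : t * nrm (L h) = nrm (L (fun n => emb t * h n)).
  by rewrite (functZ LC)// nrmM nrm_emb gtr0_norm.
apply: le_variation.
- exact: (simple_comp HA ( *%R t)).
- by move=> n; rewrite mulr_ge0// ltW.
- exact: simpleM.
- by move=> n; rewrite nrmM nrm_emb gtr0_norm// ler_wpM2l// ltW.
Qed.

End variation_theory.
End variation.

(** * Helly's theorem and near-minimal points *)

Section helly.
Variables (R : realType) (X : Type) (B : set X) (mix : R -> X -> X -> X).
Variables (n : nat) (L : nat -> X -> R) (C d : R).
Hypothesis Bmix : forall t x y, 0 <= t <= 1 -> B x -> B y -> B (mix t x y).
Hypothesis Lmix : forall t x y i, 0 <= t <= 1 -> B x -> B y ->
  L i (mix t x y) = L i x + t * (L i y - L i x).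
Hypothesis LC : forall i x, B x -> `|L i x| <= C.
Hypothesis Bd : forall t : nat -> R, (forall i, 0 <= t i) ->
  exists2 y, B y & d * (\sum_(i < n) t i) <= \sum_(i < n) t i * L i y.

Let pos (a : R) := Num.max a 0.

Let pos_sub a b : pos (a - b) ^+ 2 <= (pos a - b) ^+ 2.
Proof.
rewrite /pos /Num.max; case: ltP; case: ltP => h1 h2; rewrite ?expr0n ?sqr_ge0//.
by rewrite ler_sqr ?nnegrE; lra.
Qed.

(** Minimise the sum of the squares of the deficits [d - L i x].  At a
    near-minimal point, take the deficits as weights [t i]: a point [y] that
    satisfies the weighted inequality gives a direction in which the sum
    decreases at a rate bounded below by its infimum, so that the infimum is 0. *)
Lemma helly e : 0 < e -> exists2 x, B x & forall i, (i < n)%N -> d - e <= L i x.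
Proof.
move=> e0; pose Phi x := \sum_(i < n) pos (d - L i x) ^+ 2.
have Phi0 x : 0 <= Phi x by apply: sumr_ge0 => i _; exact: sqr_ge0.
have [b Bb _] := Bd (fun=> lexx 0).
have infP : has_inf [set Phi x | x in B].
  by split; [exists (Phi b), b|exists 0 => _ [x _ <-]].
pose I := inf [set Phi x | x in B].
have I0 : 0 <= I by apply: lb_le_inf; [exact: infP.1|move=> _ [x _ <-]].
have IPhi x : B x -> I <= Phi x by move=> Bx; apply: (ge_inf infP.2); exists x.
have [Ipos|] := ltP 0 I; last first.
  move=> I_le0; have e2 : 0 < e ^+ 2 by rewrite exprn_gt0.
  have [_ [x Bx <-] xe] := inf_adherent e2 infP.
  exists x => // i ni; rewrite leNgt; apply/negP => Li.
  suff : e ^+ 2 <= Phi x by rewrite -/I in xe; lra.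
  rewrite /Phi (bigD1 (Ordinal ni))//= -[leLHS]addr0; apply: lerD; last first.
    by apply: sumr_ge0 => j _; exact: sqr_ge0.
  rewrite ler_sqr ?nnegrE; [|lra|by rewrite /pos le_max lexx orbT].
  by rewrite /pos le_max; apply/orP; left; lra.
pose M := \sum_(i < n) (2 * C) ^+ 2.
have M0 : 0 <= M by apply: sumr_ge0 => i _; exact: sqr_ge0.
pose t := I / (M + I).
have MI : 0 < M + I by lra.
have t0 : 0 < t by rewrite divr_gt0.
have t1 : t <= 1 by rewrite ler_pdivrMr// mul1r; lra.
have tM : t * M <= I.
  by rewrite /t mulrAC ler_pdivrMr// ler_wpM2l//; lra.
have tI : 0 < t * I by rewrite mulr_gt0.
have [_ [x Bx <-] xI] := inf_adherent tI infP.
rewrite -/I in xI.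
pose p i := pos (d - L i x).
have p0 i : 0 <= p i by rewrite /p /pos le_max lexx orbT.
have [y By yP] := Bd p0.
pose D i := L i y - L i x.
have t01 : 0 <= t <= 1 by rewrite ltW.
have : Phi (mix t x y) <= Phi x - 2 * t * (\sum_(i < n) p i * D i) + t ^+ 2 * M.
  rewrite /Phi /M !mulr_sumr -sumrN -!big_split; apply: ler_sum => i _ /=.
  rewrite Lmix// opprD addrA.
  apply: le_trans (pos_sub _ _) _; rewrite -/(D i) -/(p i).
  have D2 : D i ^+ 2 <= (2 * C) ^+ 2.
    have := LC i Bx; have := LC i By; rewrite !ler_norml => h1 h2.
    by rewrite -real_normK ?num_real// ler_sqr ?nnegrE ?ler_norml /D//; lra.
  have := sqr_ge0 t; nra.
have : I <= \sum_(i < n) p i * D i.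
  apply: (le_trans (IPhi x Bx)); rewrite /Phi.
  have pp i : p i ^+ 2 = p i * (d - L i x).
    by rewrite /p /pos /Num.max; case: ltP => _; rewrite ?expr0n ?mul0r// expr2.
  under eq_bigr do rewrite pp.
  have -> : \sum_(i < n) p i * (d - L i x) =
      d * (\sum_(i < n) p i) - \sum_(i < n) p i * L i x.
    by rewrite mulr_sumr -sumrB; apply: eq_bigr => i _; ring.
  have -> : \sum_(i < n) p i * D i =
      \sum_(i < n) p i * L i y - \sum_(i < n) p i * L i x.
    by rewrite -sumrB; apply: eq_bigr => i _; rewrite /D; ring.
  by rewrite lerD2r.
have := IPhi _ (Bmix t01 Bx By).
have : t ^+ 2 * M <= t * I by rewrite expr2 -mulrA ler_wpM2l// ltW.
move: (Phi _) (\sum_(i < n) _) => a S h1 h2 h3 h4.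
have : t * I <= t * S by rewrite ler_wpM2l// ltW.
lra.
Qed.
End helly.

(** In a decreasing sequence of convex sets, near-minimisers of a quadratic
    form are a Cauchy sequence, by the parallelogram identity. *)
Lemma near_minimal (R : realType) (X : Type) (Cn : nat -> set X)
    (Q : X -> R) (D : X -> X -> R) (mid : X -> X -> X) (c : R) :
  (forall n, Cn n !=set0) ->
  (forall m n, (m <= n)%N -> Cn n `<=` Cn m) ->
  (forall n x y, Cn n x -> Cn n y -> Cn n (mid x y)) ->
  (forall x, Cn 0%N x -> 0 <= Q x <= c) ->
  (forall x y, Cn 0%N x -> Cn 0%N y -> 4 * Q (mid x y) + D x y = 2 * Q x + 2 * Q y) ->
  forall th, 0 < th -> exists n, exists2 x, Cn n x &
    forall m, (n <= m)%N -> exists2 y, Cn m y & D x y <= th.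
Proof.
move=> Cn0 Cmono Cmid Qc par th th0.
have C0 n : Cn n `<=` Cn 0%N by exact: Cmono.
have infP n : has_inf [set Q x | x in Cn n].
  split; first by have [x Cx] := Cn0 n; exists (Q x), x.
  by exists 0 => _ [x /C0/Qc/andP[? _] <-].
pose r n := inf [set Q x | x in Cn n].
have rQ n x : Cn n x -> r n <= Q x by move=> Cx; apply: (ge_inf (infP n).2); exists x.
have supP : has_sup (range r).
  split; first by exists (r 0%N), 0%N.
  exists c => _ [n _ <-]; have [x Cx] := Cn0 n.
  by apply: (le_trans (rQ n x Cx)); have /andP[] := Qc x (C0 _ _ Cx).
have th8 : 0 < th / 8 by lra.
have [_ [n _ <-] rn] := sup_adherent th8 supP.
have rsup m : r m <= sup (range r) by apply: (ub_le_sup supP.2); exists m.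
have [_ [x Cx <-] xr] := inf_adherent th8 (infP n).
exists n; exists x => // m nm.
have [_ [y Cy <-] yr] := inf_adherent th8 (infP m).
exists y => //.
have Cy' := Cmono _ _ nm _ Cy.
have := rQ n _ (Cmid n _ _ Cx Cy').
have := par x y (C0 _ _ Cx) (C0 _ _ Cy).
have := rsup n; have := rsup m.
rewrite -/(r n) in xr; rewrite -/(r m) in yr.
lra.
Qed.

(** * The limit variation and disjoint humps *)

Section hump.
Variables (R : realType) (s : scalars).
Local Notation K := (scalar_field R s).
Variable A : set (nat -> bool).
Hypothesis HA : haydon A.
Local Notation simple := (simple A).
Variables (C d : R) (L : nat -> (nat -> K) -> K).
Hypothesis LC : forall k, functional A C (L k).
Variable U : set_system nat.
Hypothesis UU : UltraFilter U.
Hypothesis Uoo : \oo `<=` U.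
Let FU : ProperFilter U := ultra_proper.
Implicit Types (g : nat -> R) (P Q : nat -> bool) (x y : nat -> K).

Definition nonneg g := simple g /\ forall n, 0 <= g n.

Definition var k g := variation A (L k) g.
(** The control measure lambda of the proof: its additivity comes from that of
    the variations. *)
Definition limit_variation g : R := @ulim R U RealScalars (fun k => var k g).
Local Notation lvar := limit_variation.

Lemma C_ge0 : 0 <= C.
Proof.
have := funct_bound (LC 0%N) (simple_cst HA (0 : K)) (c := 1).
by rewrite nrm0 mulr1 => h; apply: (le_trans (nrm_ge0 _)); apply: h => n.
Qed.

Lemma nonneg_bounded g : nonneg g -> exists2 c, 0 <= c & forall n, 0 <= g n <= c.
Proof.
move=> [sg g0]; have [c cP] := simple_bounded sg; exists c; last by move=> n; rewrite g0 cP.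
exact: le_trans (g0 0%N) (cP 0%N).
Qed.

Lemma var_ge0 k g : nonneg g -> 0 <= var k g.
Proof. by move=> [sg g0]; exact: (variation_ge0 HA (LC k)). Qed.

Lemma var_bound k g c : nonneg g -> (forall n, g n <= c) -> var k g <= C * c.
Proof.
move=> [sg g0] gc; apply: (variation_bound HA (LC k)) => // n.
by rewrite g0 gc.
Qed.

Lemma lvarP g e : nonneg g -> 0 < e -> U [set k | `|var k g - lvar g| < e].
Proof.
move=> gg; have [c c0 gc] := nonneg_bounded gg.
apply: (@ulimP _ _ UU RealScalars (fun k => var k g) (C * c)) => k.
rewrite /nrm /= ger0_norm ?var_ge0// var_bound// => n; by case/andP: (gc n).
Qed.

Lemma lvar_to g : nonneg g -> @ultra_to R U RealScalars (fun k => var k g) (lvar g).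
Proof. by move=> gg e e0; exact: lvarP. Qed.

Lemma varD k g1 g2 : nonneg g1 -> nonneg g2 ->
  var k (fun n => g1 n + g2 n) = var k g1 + var k g2.
Proof. by move=> [s1 p1] [s2 p2]; exact: (variationD HA (LC k)). Qed.

Lemma lvarD g1 g2 : nonneg g1 -> nonneg g2 ->
  lvar (fun n => g1 n + g2 n) = lvar g1 + lvar g2.
Proof.
move=> gg1 gg2; apply: (@ulimE R U UU RealScalars).
have := @ultra_toD R U UU RealScalars _ _ _ _ (lvar_to gg1) (lvar_to gg2).
by congr ultra_to; apply/funext => k; rewrite varD.
Qed.

Lemma var_mono k g1 g2 : nonneg g1 -> nonneg g2 -> (forall n, g1 n <= g2 n) ->
  var k g1 <= var k g2.
Proof. by move=> [s1 p1] [s2 p2] le12; exact: (variation_mono HA (LC k)). Qed.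

Lemma lvar_mono g1 g2 : nonneg g1 -> nonneg g2 -> (forall n, g1 n <= g2 n) ->
  lvar g1 <= lvar g2.
Proof.
move=> gg1 gg2 le12; apply/ler_addgt0Pr => e e0; have e2 : 0 < e / 2 by lra.
have [k [/= h1 h2]] : exists k, `|var k g1 - lvar g1| < e / 2 /\ `|var k g2 - lvar g2| < e / 2.
  exact: filter_ex (filterI (lvarP gg1 e2) (lvarP gg2 e2)).
have := var_mono k gg1 gg2 le12; move: h1 h2; rewrite !ltr_norml; lra.
Qed.

Lemma lvar_ge0 g : nonneg g -> 0 <= lvar g.
Proof.
move=> gg; apply/ler_addgt0Pr => e e0.
have [k /= h1] : exists k, `|var k g - lvar g| < e by exact: filter_ex (lvarP gg e0).
by have := var_ge0 k gg; move: h1; rewrite !ltr_norml; lra.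
Qed.

Lemma lvar_bound g c : nonneg g -> (forall n, g n <= c) -> lvar g <= C * c.
Proof.
move=> gg gc; apply/ler_addgt0Pr => e e0.
have [k /= h1] : exists k, `|var k g - lvar g| < e by exact: filter_ex (lvarP gg e0).
by have := var_bound k gg gc; move: h1; rewrite !ltr_norml; lra.
Qed.

Lemma lvarZ_ge g t : nonneg g -> 0 < t -> t * lvar g <= lvar (fun n => t * g n).
Proof.
move=> gg t0; have ggt : nonneg (fun n => t * g n).
  split; first by exact: (simple_comp HA ( *%R t)) gg.1.
  by move=> n; rewrite mulr_ge0// ?gg.2// ltW.
apply/ler_addgt0Pr => e e0; have e2 : 0 < e / (t + 1) by rewrite divr_gt0//; lra.
have [k [/= h1 h2]] : exists k, `|var k g - lvar g| < e / (t + 1) /\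
    `|var k (fun n => t * g n) - lvar (fun n => t * g n)| < e / (t + 1).
  exact: filter_ex (filterI (lvarP gg e2) (lvarP ggt e2)).
have := variationZ_ge HA (LC k) gg.1 gg.2 t0; rewrite -!/(var _ _).
move: h1 h2; rewrite !ltr_norml => /andP[h1 h1'] /andP[h2 h2'] h3.
have : t * lvar g <= t * (var k g + e / (t + 1)) by rewrite ler_wpM2l ?(ltW t0)//; lra.
have : t * (e / (t + 1)) + e / (t + 1) = e.
  by rewrite -[X in _ + X]mul1r -mulrDl mulrCA divff ?mulr1//; lra.
lra.
Qed.

Definition ind P : nat -> R := fun n => (P n)%:R.
Definition mass_of k P := var k (ind P).
Definition limit_mass P := lvar (ind P).
Local Notation mass := mass_of.
Local Notation lmass := limit_mass.

Lemma nonneg_ind P : A P -> nonneg (ind P).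
Proof.
move=> AP; split=> [|n]; last exact: ler0n.
exact: (simple_comp HA (fun b : bool => b%:R)) (simple_alg HA AP).
Qed.

Lemma ind_or P Q : (forall n, ~~ (P n && Q n)) ->
  ind (fun n => P n || Q n) = (fun n => ind P n + ind Q n).
Proof.
by move=> PQ; apply/funext => n; rewrite /ind; move: (PQ n); case: (P n); case: (Q n) => //= _;
  rewrite ?addr0 ?add0r.
Qed.

Lemma mass_or k P Q : A P -> A Q -> (forall n, ~~ (P n && Q n)) ->
  mass k (fun n => P n || Q n) = mass k P + mass k Q.
Proof. by move=> AP AQ PQ; rewrite /mass_of ind_or// varD//; exact: nonneg_ind. Qed.

Lemma lmass_or P Q : A P -> A Q -> (forall n, ~~ (P n && Q n)) ->
  lmass (fun n => P n || Q n) = lmass P + lmass Q.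
Proof. by move=> AP AQ PQ; rewrite /limit_mass ind_or// lvarD//; exact: nonneg_ind. Qed.

Lemma ind_mono P Q : (forall n, P n -> Q n) -> forall n, ind P n <= ind Q n.
Proof.
by move=> PQ n; rewrite /ind ler_nat; move: (PQ n); case: (P n); case: (Q n) => // /(_ isT).
Qed.

Lemma mass_mono k P Q : A P -> A Q -> (forall n, P n -> Q n) -> mass k P <= mass k Q.
Proof. by move=> AP AQ PQ; apply: var_mono; [exact: nonneg_ind..|exact: ind_mono]. Qed.

Lemma lmass_mono P Q : A P -> A Q -> (forall n, P n -> Q n) -> lmass P <= lmass Q.
Proof. by move=> AP AQ PQ; apply: lvar_mono; [exact: nonneg_ind..|exact: ind_mono]. Qed.

Lemma mass_diff k P Q : A P -> A Q -> mass k P <= mass k Q + mass k (fun n => P n && ~~ Q n).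
Proof.
move=> AP AQ; have AD := alg_diff HA AP AQ.
rewrite -mass_or//; last by move=> n; case: (Q n); rewrite ?andbF.
apply: mass_mono => //; first exact: alg_or.
by move=> n ->; case: (Q n).
Qed.

Lemma lmass_union_le P Q : A P -> A Q -> lmass (fun n => P n || Q n) <= lmass P + lmass Q.
Proof.
move=> AP AQ; have AD := alg_diff HA AQ AP.
have -> : (fun n => P n || Q n) = (fun n => P n || (Q n && ~~ P n)).
  by apply/funext => n; case: (P n); case: (Q n).
rewrite lmass_or//; last by move=> n; case: (P n); rewrite ?andbF.
by rewrite lerD2l; apply: lmass_mono => // n /andP[].
Qed.

Lemma lmass_ge0 P : A P -> 0 <= lmass P.
Proof. by move=> AP; exact/lvar_ge0/nonneg_ind. Qed.

Lemma mass_ge0 k P : A P -> 0 <= mass k P.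
Proof. by move=> AP; exact/var_ge0/nonneg_ind. Qed.

Lemma mass_leC k P : A P -> mass k P <= C.
Proof.
move=> AP; rewrite -[C]mulr1; apply: var_bound; first exact: nonneg_ind.
by move=> n; rewrite /ind; case: (P n).
Qed.

Lemma lmass_leC P : A P -> lmass P <= C.
Proof.
move=> AP; rewrite -[C]mulr1; apply: lvar_bound; first exact: nonneg_ind.
by move=> n; rewrite /ind; case: (P n).
Qed.

(** This is why the limit of the variations controls the sets chosen later: a
    set that is small for the limit is small for almost all [L k]. *)
Lemma near_mass P b : A P -> lmass P < b -> U [set k | mass k P < b].
Proof.
move=> AP Pb; have e0 : 0 < b - lmass P by lra.
apply: filterS (lvarP (nonneg_ind AP) e0) => k /=.
by rewrite ltr_norml -/(mass k P) -/(lmass P); lra.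
Qed.

Lemma lmass_disjoint_small (S : nat -> nat -> bool) c : 0 < c ->
  (forall p, A (S p)) -> (forall p q n, S p n -> S q n -> p = q) ->
  exists p, lmass (S p) < c.
Proof.
move=> c0 AS dS; apply: contrapT => /forallNP h.
have AU N : A (fun n => has (fun p => S p n) (iota 0 N)) by exact: alg_has.
have big N : N%:R * c <= lmass (fun n => has (fun p => S p n) (iota 0 N)).
  elim: N => [|N IH]; first by rewrite mul0r lmass_ge0.
  have -> : (fun n => has (fun p => S p n) (iota 0 N.+1)) =
            (fun n => has (fun p => S p n) (iota 0 N) || S N n).
    by apply/funext => n; rewrite -[N.+1]addn1 iotaD has_cat /= orbF.
  rewrite lmass_or//; last first.
    move=> n; apply/negP => /andP[/hasP[p]]; rewrite mem_iota /= add0n => pN Sp SN.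
    by rewrite (dS _ _ _ Sp SN) ltnn in pN.
  rewrite -natr1 mulrDl mul1r lerD// leNgt; apply/negP; exact: h.
have := big (Num.bound (C / c)); have := lmass_leC (AU (Num.bound (C / c))).
have : C < (Num.bound (C / c))%:R * c.
  by rewrite -ltr_pdivrMr// archi_boundP// divr_ge0// ?C_ge0// ltW.
lra.
Qed.

(** [eta] is the infimum of the levels [c] such that, for almost all [k], sets
    of small limit mass have mass at most [c] for [L k]. *)
Lemma modulus e : 0 < e -> exists eta del, [/\ 0 < del,
    U [set k | forall P, A P -> lmass P < del -> mass k P <= eta + e] &
    forall c, 0 < c -> U [set k | exists P, [/\ A P, lmass P < c & eta - e < mass k P]]].
Proof.
move=> e0.
pose E c := exists2 del, 0 < del & U [set k | forall P, A P -> lmass P < del -> mass k P <= c].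
have E_ge0 c : E c -> 0 <= c.
  move=> [del del0 /filter_ex[k /= kP]]; have A0 := alg_false HA.
  apply: (le_trans (mass_ge0 k A0)); apply: kP => //.
  have -> // : lmass (fun=> false) = 0.
  apply/eqP; rewrite eq_le lmass_ge0// andbT; rewrite -[leRHS](mulr0 C).
  by apply: lvar_bound => //; exact: nonneg_ind.
have infE : has_inf E.
  split; last by exists 0 => c /E_ge0.
  exists C, 1 => //; apply: filterE => k P AP _; exact: mass_leC.
have [c [del del0 cU] ce] := inf_adherent e0 infE.
exists (inf E), del; split => //.
  by apply: filterS cU => k kP P AP Pd; apply: (le_trans (kP P AP Pd)); exact: ltW.
move=> b b0; have [h|] := in_ultra_setVsetC
    [set k | forall P, A P -> lmass P < b -> mass k P <= inf E - e] UU.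
  have : inf E <= inf E - e by apply: (ge_inf infE.2); exists b.
  lra.
apply: filterS => k /= /existsNP[P /not_implyP[AP /not_implyP[Pb /negP]]].
by rewrite -ltNge => h; exists P.
Qed.

(** Each new hump is removed from the union [D] of the previous ones, which has
    limit mass less than [c], hence mass less than [c] for almost all [L k].
    The strict inequality leaves room for one more hump. *)
Lemma disjoint_humps (W : set nat) eta e c : U W -> 0 < c -> c <= e ->
  (forall b, 0 < b -> U [set k | exists P, [/\ A P, lmass P < b & eta - e < mass k P]]) ->
  exists (k : nat -> nat) (P : nat -> nat -> bool),
    [/\ forall i, W (k i) /\ (i <= k i)%N,
        forall i, [/\ A (P i), lmass (P i) < c & eta - 2 * e <= mass (k i) (P i)] &
        forall i j n, P i n -> P j n -> i = j].
Proof.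
move=> UW c0 ce hump.
(* A state consists of an index, the last hump, and the union of the humps so
   far. *)
pose ok (st : nat * (nat -> bool) * (nat -> bool)) := A st.2 /\ lmass st.2 < c.
pose good (D : nat -> bool) (st : nat * (nat -> bool) * (nat -> bool)) :=
  [/\ [/\ W st.1.1, A st.1.2, lmass st.1.2 < c & eta - 2 * e <= mass st.1.1 st.1.2],
      (forall n, st.1.2 n -> ~~ D n), (forall n, D n -> st.2 n) &
      (forall n, st.1.2 n -> st.2 n)].
have step st : exists st', ok st -> [/\ ok st', good st.2 st' & (st.1.1 < st'.1.1)%N].
  case: st => [[k0 P0] D]; rewrite /ok /=.
  have [[AD Dc]|nok] := pselect (A D /\ lmass D < c); last by exists (k0, P0, D).
  have cD : 0 < c - lmass D by lra.
  have Uk : U [set k | (k0 < k)%N] by apply: Uoo; exists k0.+1.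
  have [k [[/= Wk k0k] [kD [Q [AQ Qc Qm]]]]] : exists k, ((W k /\ (k0 < k)%N) /\
      (mass k D < c /\ exists Q, [/\ A Q, lmass Q < c - lmass D & eta - e < mass k Q])).
    exact: filter_ex (filterI (filterI UW Uk) (filterI (near_mass AD Dc) (hump _ cD))).
  have AQD := alg_diff HA AQ AD.
  have AU := alg_or HA AD AQ.
  exists (k, fun n => Q n && ~~ D n, fun n => D n || Q n) => _; rewrite /good /ok /=.
  have UQ := lmass_union_le AD AQ.
  split=> //; first by split=> //; lra.
  split.
  - split=> //; last by have := mass_diff k AQ AD; lra.
    have : lmass (fun n => Q n && ~~ D n) <= lmass Q by apply: lmass_mono => // n /andP[].
    have := lmass_ge0 AD; lra.
  - by move=> n /andP[].
  - by move=> n ->.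
  - by move=> n /andP[->]; rewrite orbT.
have [f fP] := choice step.
pose S := fix S i := if i is i'.+1 then f (S i') else f (0%N, fun=> false, fun=> false).
have ok0 : ok (0%N, fun=> false, fun=> false).
  split; first exact: alg_false.
  suff : lmass (fun=> false) <= C * 0 by rewrite mulr0 => h; exact: le_lt_trans h c0.
  by apply: lvar_bound => //; apply: nonneg_ind; exact: alg_false.
have SP i : ok (S i) /\ exists D, good D (S i).
  elim: i => [|i [IH _]] /=.
    by have [? ? _] := fP _ ok0; split => //; eexists; eassumption.
  by have [? ? _] := fP _ IH; split => //; eexists; eassumption.
have Sn i : good (S i).2 (S i.+1) /\ ((S i).1.1 < (S i.+1).1.1)%N.
  by have [ok_i _] := SP i; have [] := fP _ ok_i.
have Dmono i j n : (i <= j)%N -> (S i).2 n -> (S j).2 n.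
  move=> /subnKC <-; elim: (j - i)%N => [|m IH]; first by rewrite addn0.
  by move=> /IH h; rewrite addnS; have [[_ _ sub _] _] := Sn (i + m)%N; exact: sub.
have dis i j n : (i < j)%N -> (S i).1.2 n -> (S j).1.2 n -> False.
  case: j => // j; rewrite ltnS => ij Pi Pj.
  have [[_ nD _ _] _] := Sn j.
  have [_ [D [_ _ _ sub]]] := SP i.
  by have := nD n Pj; rewrite (Dmono i j n ij (sub n Pi)).
exists (fun i => (S i).1.1), (fun i => (S i).1.2); split.
- move=> i; split; first by have [_ [D [[]]]] := SP i.
  by elim: i => // i IH; have [_ h] := Sn i; exact: leq_ltn_trans h.
- by move=> i; have [_ [D [[]]]] := SP i.
- by move=> i j n Pi Pj; have [/dis/(_ Pi Pj)|/dis/(_ Pj Pi)|] := ltngtP i j.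
Qed.

End hump.

(** * A point that almost attains the bound infinitely often *)

Section main_hump.
Variables (R : realType) (s : scalars).
Local Notation K := (scalar_field R s).
Variable A : set (nat -> bool).
Hypothesis HA : haydon A.
Local Notation simple := (simple A).
Variables (C d : R) (L : nat -> (nat -> K) -> K).
Hypothesis LC : forall k, functional A C (L k).
Implicit Types (g : nat -> R) (P Q : nat -> bool) (x y : nat -> K).

Definition in_ball x := simple x /\ forall n, nrm (x n) <= 1.

Hypothesis duality : forall n (t : nat -> R), (forall i, 0 <= t i) ->
  exists2 y, in_ball y & d * (\sum_(i < n) t i) <= \sum_(i < n) t i * rp (L i y).

Definition restrict P x := fun n => if P n then x n else 0.

Lemma simple_restrict P x : A P -> simple x -> simple (restrict P x).
Proof. by move=> AP sx; apply: simple_if => //; exact: simple_cst. Qed.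

Local Notation mass := (mass_of A L).

Lemma restrict_le_mass k P x : A P -> in_ball x -> nrm (L k (restrict P x)) <= mass k P.
Proof.
move=> AP [sx x1]; have [sP P0] := nonneg_ind R HA AP.
apply: (le_variation HA (LC k)) => //; first exact: simple_restrict.
by move=> n; rewrite /restrict /ind; case: (P n) => //; rewrite nrm0.
Qed.

Lemma mass_setD k P Q : A P -> A Q -> (forall n, P n -> Q n) ->
  mass k (fun n => Q n && ~~ P n) = mass k Q - mass k P.
Proof.
move=> AP AQ PQ; apply/eqP; rewrite eq_sym subr_eq addrC; apply/eqP.
rewrite -(mass_or HA LC k AP (alg_diff HA AQ AP)); last by move=> n; case: (P n); rewrite ?andbF.
by congr (mass_of A L k _); apply/funext => n; move: (PQ n); case: (P n); case: (Q n) => // /(_ isT).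
Qed.

Lemma functB k x y : simple x -> simple y -> L k (fun n => x n - y n) = L k x - L k y.
Proof.
move=> sx sy; have := functD (LC k) sx (simpleM HA (-1) sy).
rewrite (functZ (LC k))// mulN1r => <-; congr (L k).
by apply/funext => n; rewrite mulN1r.
Qed.

(** The part of [x] off [P] can be replaced by that of [y]: on the part of [Q]
    off [P] each of the two costs at most the mass, and off [Q] they are close. *)
Lemma restrict_close k P Q b x y : A P -> A Q -> (forall n, P n -> Q n) ->
  in_ball x -> in_ball y -> 0 <= b -> (forall n, ~~ Q n -> nrm (x n - y n) <= b) ->
  rp (L k (restrict (fun n => ~~ P n) y)) - 2 * mass k (fun n => Q n && ~~ P n) - C * b
   <= rp (L k (restrict (fun n => ~~ P n) x)).
Proof.
move=> AP AQ PQ bx by_ b0 xy; have AD := alg_diff HA AQ AP.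
have [sx x1] := bx; have [sy y1] := by_.
pose D n := Q n && ~~ P n.
have AnP := alg_not HA AP; have AnQ := alg_not HA AQ.
pose z := restrict (fun n => ~~ Q n) (fun n => y n - x n).
have sz : simple z.
  by apply: simple_restrict => //; exact: (simple_comp2 HA (fun a c => a - c) sy sx).
have eq1 : restrict (fun n => ~~ P n) y = (fun n => restrict (fun n => ~~ P n) x n +
    ((restrict D y n - restrict D x n) + z n)).
  apply/funext => n; rewrite /z /restrict /D; move: (PQ n).
  by case: (P n); case: (Q n) => /= PQn; first [by have := PQn isT|ring].
have sD x' : simple x' -> simple (restrict D x') by exact: simple_restrict.
have sDB : simple (fun n => restrict D y n - restrict D x n).
  exact: (simple_comp2 HA (fun a c => a - c) (sD _ sy) (sD _ sx)).
have snP := simple_restrict AnP sx.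
have -> : rp (L k (restrict (fun n => ~~ P n) y)) =
    rp (L k (restrict (fun n => ~~ P n) x)) +
    (rp (L k (restrict D y)) - rp (L k (restrict D x)) + rp (L k z)).
  rewrite {1}eq1 (functD (LC k))//; last exact: (simple_comp2 HA +%R sDB sz).
  by rewrite (functD (LC k))// functB ?rpD ?rpN//; exact: sD.
have h1 := restrict_le_mass k AD by_; have h2 := restrict_le_mass k AD bx.
have h3 : nrm (L k z) <= C * b.
  apply: (funct_bound (LC k)) => // n; rewrite /z /restrict.
  by case: ifPn => [/xy|]; rewrite ?nrm0// nrmC.
have := rp_le_nrm (L k (restrict D y)); have := rp_ge_nrm (L k (restrict D x)).
have := rp_le_nrm (L k z); rewrite -/D in h1 h2 *.
lra.
Qed.

(** The sets [W l] may overlap; the largest index wins. *)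
Fixpoint blend (W : nat -> nat -> bool) (c : nat -> K) x m : nat -> K :=
  if m is m'.+1 then fun n => if W m' n then c m' else blend W c x m' n else x.

Lemma simple_blend (W : nat -> nat -> bool) (c : nat -> K) x m :
  (forall l, A (W l)) -> simple x -> simple (blend W c x m).
Proof.
by move=> AW sx; elim: m => //= m IH; apply: simple_if => //; exact: simple_cst.
Qed.

Lemma blendP (W : nat -> nat -> bool) (c : nat -> K) x m n : (exists l, [/\ (l < m)%N, W l n & blend W c x m n = c l]) \/
  (forall l, (l < m)%N -> ~~ W l n) /\ blend W c x m n = x n.
Proof.
elim: m => [|m IH] /=; first by right.
case: ifPn => Wm; first by left; exists m.
case: IH => [[l [lm Wl E]]|[nW E]]; first by left; exists l; split => //; exact: leqW.
by right; split => // l; rewrite ltnS leq_eqVlt => /orP[/eqP ->|/nW].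
Qed.

Definition mix (t : R) x y : nat -> K := fun n => emb (1 - t) * x n + emb t * y n.

Lemma simple_mix t x y : simple x -> simple y -> simple (mix t x y).
Proof. exact: (simple_comp2 HA (fun a b => emb (1 - t) * a + emb t * b)). Qed.

Lemma in_ball_mix t x y : 0 <= t <= 1 -> in_ball x -> in_ball y -> in_ball (mix t x y).
Proof.
move=> /andP[t0 t1] [sx x1] [sy y1]; split=> [|n]; first exact: simple_mix.
apply: (le_trans (nrmD _ _)); rewrite !nrmM !nrm_emb !ger0_norm//; last by lra.
have := x1 n; have := y1 n; nra.
Qed.

Lemma rp_mix k t x y : simple x -> simple y ->
  rp (L k (mix t x y)) = rp (L k x) + t * (rp (L k y) - rp (L k x)).
Proof.
move=> sx sy; rewrite /mix (functD (LC k)); [|exact: simpleM..].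
rewrite !(functZ (LC k))// rpD !rpZ; ring.
Qed.

Variable U : set_system nat.
Hypothesis UU : UltraFilter U.
Hypothesis Uoo : \oo `<=` U.
Let FU : ProperFilter U := ultra_proper.
Local Notation lvar := (limit_variation A L U).
Local Notation lmass := (limit_mass A L U).

Let nonneg_sq x y : simple x -> simple y -> nonneg A (fun n => nrm (x n - y n) ^+ 2).
Proof.
move=> sx sy; split=> [|n]; last exact: sqr_ge0.
exact: (simple_comp2 HA (fun a b => nrm (a - b) ^+ 2)).
Qed.

Let nonneg_sq1 x : simple x -> nonneg A (fun n => nrm (x n) ^+ 2).
Proof.
move=> sx; split=> [|n]; last exact: sqr_ge0.
exact: (simple_comp HA (fun a => nrm a ^+ 2)).
Qed.

(** [y] depends on [k] and [x] does not: for a near-minimal [x], the points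
    that serve more and more functionals stay within [th] of [x] in the square
    mean. *)
Lemma central_point e th : 0 < e -> 0 < th -> exists2 x, in_ball x &
  forall k, exists y, [/\ in_ball y, d - e <= rp (L k y) &
    lvar (fun n => nrm (x n - y n) ^+ 2) <= th].
Proof.
move=> e0 th0.
pose Cn n := [set x | in_ball x /\ forall i, (i < n)%N -> d - e <= rp (L i x)].
have h2 : 0 <= (1 / 2 : R) <= 1 by lra.
have lam2 g : nonneg A g -> lvar (fun n => 2 * g n) = 2 * lvar g.
  move=> gg; have -> : 2 * lvar g = lvar g + lvar g by ring.
  rewrite -(lvarD HA LC UU gg gg); congr (limit_variation A L U _).
  by apply/funext => n; ring.
have nonneg2 g : nonneg A g -> nonneg A (fun n => 2 * g n).
  move=> [sg g0]; split=> [|n]; last by rewrite mulr_ge0.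
  exact: (simple_comp HA ( *%R 2)).
have [|||||n [x [bx _] xP]] := @near_minimal R (nat -> K) Cn
    (fun x => lvar (fun n => nrm (x n) ^+ 2))
    (fun x y => lvar (fun n => nrm (x n - y n) ^+ 2)) (mix (1 / 2)) C _ _ _ _ _ th th0.
- move=> n; have [|||x bx xP] := @helly R (nat -> K) in_ball mix n
    (fun i x => rp (L i x)) C d _ _ _ (duality n) e e0.
  + by move=> t x y t01 bx by_; exact: in_ball_mix.
  + by move=> t x y i t01 [sx _] [sy _]; exact: rp_mix.
  + move=> i x [sx x1]; have := rp_le_nrm (L i x); have := rp_ge_nrm (L i x).
    have := funct_bound (LC i) sx x1; rewrite mulr1 ler_norml; lra.
  + by exists x.
- by move=> m n mn x [bx xP]; split=> // i im; apply: xP; exact: leq_trans mn.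
- move=> n x y [bx xP] [by_ yP]; split; first exact: in_ball_mix.
  move=> i ni; rewrite rp_mix; [|exact: bx.1|exact: by_.1].
  have := xP i ni; have := yP i ni; lra.
- move=> x [[sx x1] _]; apply/andP; split; first exact: (lvar_ge0 HA LC UU (nonneg_sq1 sx)).
  rewrite -[X in _ <= X]mulr1; apply: (lvar_bound HA LC UU) => // [|n]; first exact: nonneg_sq1.
  by rewrite expr_le1 ?nrm_ge0.
- move=> x y [[sx _] _] [[sy _] _].
  have sm := simple_mix (1 / 2) sx sy.
  have -> : 4 * lvar (fun n => nrm (mix (1 / 2) x y n) ^+ 2) =
      lvar (fun n => nrm (x n + y n) ^+ 2).
    have -> : 4 = 2 * 2 :> R by ring.
    rewrite -mulrA -(lam2 _ (nonneg_sq1 sm)) -(lam2 _ (nonneg2 _ (nonneg_sq1 sm))); congr (limit_variation A L U _); apply/funext => n.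
    have -> : x n + y n = emb 2 * mix (1 / 2) x y n.
      rewrite /mix mulrDr !mulrA -!embM.
      have -> : 2 * (1 - 1 / 2) = 1 :> R by lra.
      have -> : 2 * (1 / 2) = 1 :> R by lra.
      by rewrite emb1 !mul1r.
    by rewrite nrmM nrm_emb ger0_norm//; ring.
  rewrite -(lvarD HA LC UU (nonneg_sq1 (simple_comp2 HA +%R sx sy)) (nonneg_sq sx sy)).
  rewrite -(lam2 _ (nonneg_sq1 sx)) -(lam2 _ (nonneg_sq1 sy)).
  rewrite -(lvarD HA LC UU (nonneg2 _ (nonneg_sq1 sx)) (nonneg2 _ (nonneg_sq1 sy))).
  congr (limit_variation A L U _).
  by apply/funext => m; exact: nrm_parallelogram.
exists x => // k.
have [y [by_ yP] xy] := xP (maxn n k.+1) (leq_maxl _ _).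
by exists y; split=> //; apply: yP; rewrite leq_max ltnSn orbT.
Qed.

(** With [C] bounding the functionals, the constant collects the errors.  The
    bound for [x0] off the hump loses 8 + C, the hump itself 3 + C, and
    exchanging [x] for [x0] off the hump 6. *)
Lemma recurrent_point_ultra e : 0 < e ->
  exists2 x, in_ball x & forall N, exists2 k, (N <= k)%N &
    d - (17 + 2 * C) * e <= rp (L k x).
Proof.
move=> e0; have C0 := C_ge0 HA LC.
have [eta [del [del0 Umod Uhump]]] := modulus HA LC UU e0.
pose c := Num.min e (del / 2).
have c0 : 0 < c by rewrite lt_min e0 /=; lra.
have ce : c <= e by rewrite ge_min lexx.
have cdel : c <= del / 2 by rewrite ge_min lexx orbT.
have th0 : 0 < e ^+ 2 * (c / 2) by rewrite mulr_gt0 ?exprn_gt0//; lra.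
have [x0 bx0 x0P] := central_point e0 th0.
have [k [P [kW PP Pdisj]]] := disjoint_humps HA LC UU Uoo Umod c0 ce Uhump.
have kmod i Q : A Q -> lmass Q < del -> mass (k i) Q <= eta + e by exact: (kW i).1.
have AP i : A (P i) by have [] := PP i.
have massP i : eta - 2 * e <= mass (k i) (P i) <= eta + e.
  have [_ Pc Pm] := PP i; rewrite Pm /= kmod//; lra.
(* Off the humps, [x0] nearly attains d - eta for every functional [L (k i)]. *)
have off i : d - eta - (8 + C) * e <=
    rp (L (k i) (restrict (fun n => ~~ P i n) x0)).
  have [y [by_ yd xy]] := x0P (k i).
  pose D n := e < nrm (x0 n - y n).
  have AD : A D.
    have := simple_preim HA (fun a => e < nrm a)
      (simple_comp2 HA (fun a b => a - b) bx0.1 by_.1).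
    by [].
  have lD : lmass D < c.
    have e20 : 0 < e ^+ 2 by rewrite exprn_gt0.
    have h1 := lvarZ_ge HA LC UU (nonneg_ind R HA AD) e20.
    have h2 : lvar (fun n => e ^+ 2 * ind R D n) <= lvar (fun n => nrm (x0 n - y n) ^+ 2).
      apply: (lvar_mono HA LC UU) => //.
      - split=> [|n]; last by rewrite mulr_ge0 ?(ltW e20)// ler0n.
        exact: (simple_comp HA ( *%R (e ^+ 2)) (nonneg_ind R HA AD).1).
      - by apply: nonneg_sq; [exact: bx0.1|exact: by_.1].
      - move=> n; rewrite /ind /D; case: ltP => h; rewrite ?mulr1 ?mulr0 ?sqr_ge0//.
        by rewrite ler_sqr ?nnegrE ?nrm_ge0 ?ltW//.
    have : e ^+ 2 * lmass D <= e ^+ 2 * (c / 2) by apply: le_trans h1 (le_trans h2 xy).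
    rewrite ler_pM2l//; lra.
  have AQ := alg_or HA (AP i) AD.
  have mQ : mass (k i) (fun n => P i n || D n) <= eta + e.
    apply: kmod => //; have := lmass_union_le HA LC UU (AP i) AD.
    have [_ Pc _] := PP i; lra.
  have mdiff : mass (k i) (fun n => (P i n || D n) && ~~ P i n) <= 3 * e.
    rewrite mass_setD//; last by move=> n ->.
    have := massP i; lra.
  have close n : ~~ (P i n || D n) -> nrm (x0 n - y n) <= e.
    by rewrite negb_or => /andP[_]; rewrite /D -leNgt.
  have := restrict_close (k i) (AP i) AQ (fun n h => (introT orP (or_introl h)))
    bx0 by_ (ltW e0) close.
  have Ly : L (k i) y = L (k i) (restrict (P i) y) +
      L (k i) (restrict (fun n => ~~ P i n) y).
    rewrite -(functD (LC (k i))); [|exact: simple_restrict (AP i) by_.1|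
      exact: simple_restrict (alg_not HA (AP i)) by_.1].
    congr (L (k i)); apply/funext => n; rewrite /restrict.
    by case: (P i n); rewrite ?addr0 ?add0r.
  have : rp (L (k i) (restrict (P i) y)) <= eta + e.
    apply: le_trans (rp_le_nrm _) _; apply: le_trans (restrict_le_mass _ (AP i) by_) _.
    by case/andP: (massP i).
  move: yd; rewrite Ly rpD; lra.
have /choice[h hP] i : exists h, [/\ simple h, forall n, nrm (h n) <= ind R (P i) n &
    eta - 3 * e <= rp (L (k i) h)].
  have [sP P0] := nonneg_ind R HA (AP i).
  have [h [sh hg hm hE]] := variation_approx HA (LC (k i)) sP P0 e0.
  exists h; split => //; rewrite hE rp_emb; have := massP i.
  by rewrite -/(var A L (k i) _) -/(mass (k i) (P i)) in hm; lra.
(* The functions [h i] are rounded to finitely many values, so that the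
   selected humps glue to a simple function. *)
have [net [net1 netP]] := disc_net s e0.
pose B i l n := [&& P i n, (l < size net)%N & nrm (h i n - net`_l) <= e].
have AB i l : A (B i l).
  apply: (alg_and HA (AP i)); apply: (alg_and HA); first exact: alg_cst.
  exact: (simple_preim HA (fun a => nrm (a - net`_l) <= e) (let: And3 sh _ _ := hP i in sh)).
(* The humps are split into infinitely many families, and for each of them the
   algebra contains the union of a subfamily. *)
have /choice[J JP] (p : nat) : exists J : nat -> bool, infinite J /\
    forall l, A (unionover J (fun j => B (pickle (p, j))) l).
  have [||J infJ AJ] := @alg_subunion _ HA (fun j => B (pickle (p, j : nat))).
  - by move=> j l; exact: AB.
  - move=> j j' l l' n /and3P[Pj _ _] /and3P[Pj' _ _].
    by have /(pcan_inj pickleK)[] := Pdisj _ _ _ Pj Pj'.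
  - by exists J.
pose W p := unionover (J p) (fun j => B (pickle (p, j))).
have AW p l : A (W p l) by have [_] := JP p; exact.
have WP p l n : W p l n -> exists j, [/\ J p j, P (pickle (p, j)) n,
    (l < size net)%N & nrm (h (pickle (p, j)) n - net`_l) <= e].
  by move=> /asboolP[j Jj /and3P[? ? ?]]; exists j.
pose S p n := has (fun l => W p l n) (iota 0 (size net)).
have AS p : A (S p) by exact: alg_has.
have Sdisj p q n : S p n -> S q n -> p = q.
  move=> /hasP[l _ /WP[j [_ Pj _ _]]] /hasP[l' _ /WP[j' [_ Pj' _ _]]].
  by have /(pcan_inj pickleK)[] := Pdisj _ _ _ Pj Pj'.
have [p Sp] := lmass_disjoint_small HA LC UU del0 AS Sdisj.
pose x := blend (W p) (fun l => net`_l) x0 (size net).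
have bx : in_ball x.
  split; first by apply: simple_blend; [exact: AW|exact: bx0.1].
  move=> n; rewrite /x; have [[l [ln _ ->]]|[_ ->]] := blendP (W p) (fun l => net`_l) x0 (size net) n.
    by apply: net1; exact: mem_nth.
  exact: bx0.2.
exists x => // N; have [infJ _] := JP p.
have [j jN Jj] : exists2 j, (N <= pickle (p, j))%N & J p j.
  have [g gmono gJ] := infinite_enum infJ.
  have inj : injective (fun n => pickle (p, g n)).
    move=> a b /(pcan_inj pickleK)[] gab.
    by have [/gmono|/gmono|//] := ltngtP a b; rewrite gab ltnn.
  by have [m Nm /asboolP[n nm]] := infinite_range inj N; exists (g n); rewrite ?nm.
pose i := pickle (p, j); exists (k i); first exact: leq_trans jN (kW i).2.
have PS n : P i n -> S p n.
  move=> Pi; have [sh hi _] := hP i.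
  have [|w wnet hw] := netP (h i n).
    by apply: le_trans (hi n) _; rewrite /ind; case: (P i n).
  apply/hasP; exists (index w net); first by rewrite mem_iota /= add0n index_mem.
  by apply/asboolP; exists j => //; rewrite /B Pi index_mem wnet nth_index.
have close n : P i n -> nrm (x n - h i n) <= e.
  move=> Pi; rewrite /x.
  have [[l [ln Wl ->]]|[nW _]] := blendP (W p) (fun l => net`_l) x0 (size net) n.
    have [j' [_ Pj' _ hl]] := WP _ _ _ Wl.
    by rewrite nrmC (Pdisj _ _ _ Pi Pj').
  by have /hasP[l] := PS n Pi; rewrite mem_iota /= add0n => /nW /negP.
have far n : ~~ S p n -> nrm (x n - x0 n) <= 0.
  move=> /hasPn nS; rewrite /x.
  have [[l [ln Wl _]]|[_ ->]] := blendP (W p) (fun l => net`_l) x0 (size net) n.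
    by have := nS l; rewrite mem_iota /= add0n ln Wl => /(_ isT).
  by rewrite subrr nrm0.
have mdiff : mass (k i) (fun n => S p n && ~~ P i n) <= 3 * e.
  by rewrite mass_setD//; have := kmod i _ (AS p) Sp; have := massP i; lra.
have h1 := restrict_close (k i) (AP i) (AS p) PS bx bx0 (lexx 0) far.
have Lx : L (k i) x = L (k i) (restrict (P i) x) +
    L (k i) (restrict (fun n => ~~ P i n) x).
  rewrite -(functD (LC (k i))); [|exact: simple_restrict (AP i) bx.1|
    exact: simple_restrict (alg_not HA (AP i)) bx.1].
  congr (L (k i)); apply/funext => n; rewrite /restrict.
  by case: (P i n); rewrite ?addr0 ?add0r.
have [sh hi hm] := hP i.
have h2 : eta - 3 * e - C * e <= rp (L (k i) (restrict (P i) x)).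
  have sPx := simple_restrict (AP i) bx.1.
  have : nrm (L (k i) (fun n => restrict (P i) x n - h i n)) <= C * e.
    apply: (funct_bound (LC (k i))); first exact: (simple_comp2 HA (fun a b => a - b)).
    move=> n; rewrite /restrict; case: ifPn => [/close//|nP].
    have -> : h i n = 0.
      apply/nrm_eq0/eqP; rewrite eq_le nrm_ge0 andbT.
      by apply: le_trans (hi n) _; rewrite /ind (negbTE nP).
    by rewrite subrr nrm0 ltW.
  rewrite functB// => h3; have := rp_ge_nrm (L (k i) (restrict (P i) x) - L (k i) (h i)).
  rewrite rpB; lra.
have := off i; rewrite Lx rpD; lra.
Qed.

End main_hump.

Lemma exists_ultra_oo : exists2 U : set_system nat, UltraFilter U & \oo `<=` U.
Proof.
by have [U [UU oU]] := ultraFilterLemma (eventually_filter); exists U.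
Qed.

(** The weighted inequality is what a bidual functional of norm at most 1 whose
    real part is at least [d] on every [L k] forces, up to an error in [d]. *)
Lemma recurrent_point (R : realType) (s : scalars) (A : set (nat -> bool))
    (C d : R) (L : nat -> (nat -> scalar_field R s) -> scalar_field R s) :
  haydon A -> (forall k, functional A C (L k)) ->
  (forall n (t : nat -> R), (forall i, 0 <= t i) ->
    exists2 y, in_ball A y & d * (\sum_(i < n) t i) <= \sum_(i < n) t i * rp (L i y)) ->
  forall e, 0 < e -> exists2 x, in_ball A x &
    forall N, exists2 k, (N <= k)%N & d - e <= rp (L k x).
Proof.
move=> HA LC dual e e0; have [U UU Uoo] := exists_ultra_oo.
have C0 := C_ge0 HA LC.
have e' : 0 < e / (17 + 2 * C) by rewrite divr_gt0//; lra.
have [x bx xP] := recurrent_point_ultra HA LC dual UU Uoo e'.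
exists x => // N; have [k Nk kP] := xP N; exists k => //.
by move: kP; rewrite mulrCA divff ?mulr1//; lra.
Qed.

(** * The Banach space *)

Section vnrm.
Variables (R : realType) (s : scalars).
Local Notation K := (scalar_field R s).
Variable V : normedModType K.
Implicit Types u v : V.

Definition vnrm v : R := rp (`|v| : K).

Lemma norm_vnrm v : `|v| = emb (vnrm v).
Proof. exact/ge0_emb/normr_ge0. Qed.
Lemma vnrm_ge0 v : 0 <= vnrm v.
Proof. by rewrite -(ler_emb s 0) -norm_vnrm emb0. Qed.
Lemma vnrmD u v : vnrm (u + v) <= vnrm u + vnrm v.
Proof. by rewrite -(ler_emb s) embD -!norm_vnrm ler_normD. Qed.
Lemma vnrmZ (a : K) v : vnrm (a *: v) = nrm a * vnrm v.
Proof.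
have : emb (vnrm (a *: v)) = emb (nrm a * vnrm v) :> K.
  by rewrite embM -norm_emb -!norm_vnrm normrZ.
by move=> /(congr1 (@rp R s)); rewrite !rp_emb.
Qed.
Lemma vnrm0 : vnrm 0 = 0.
Proof. by rewrite /vnrm normr0 -emb0 rp_emb. Qed.
Lemma vnrmN v : vnrm (- v) = vnrm v.
Proof. by rewrite /vnrm normrN. Qed.
Lemma vnrm_eq0 v : vnrm v = 0 -> v = 0.
Proof. by move=> v0; apply/eqP; rewrite -normr_eq0 norm_vnrm v0 emb0. Qed.
Lemma vball v r : ball v (emb r : K) = [set w | vnrm (v - w) < r].
Proof.
by rewrite -ball_normE /ball_; apply/seteqP; split => w /=; rewrite norm_vnrm ltr_emb.
Qed.
Lemma unit_ballE v : unit_ball V v <-> vnrm v <= 1.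
Proof. by rewrite /unit_ball /= norm_vnrm -emb1 ler_emb. Qed.
End vnrm.

Section space.
Variables (R : realType) (s : scalars) (B : {A | haydon A}).
Local Notation K := (scalar_field R s).
Local Notation A := (projT1 B).
Let HA : haydon A := projT2 B.

Definition approximable : {pred nat -> K^o} :=
  [pred f | `[< forall e : R, 0 < e ->
     exists2 g : nat -> K, simple A g & forall n, nrm (f n - g n : K) <= e >]].

Lemma simple_approximable (g : nat -> K) : simple A g -> g \in approximable.
Proof.
by move=> sg; apply/asboolP => e e0; exists g => // n; rewrite subrr nrm0 ltW.
Qed.

Lemma approximable_submod_closed : submod_closed approximable.
Proof.
split=> [|a f g /asboolP fP /asboolP gP].
  by apply: simple_approximable; exact: (simple_cst HA (0 : K)).
apply/asboolP => e e0.
have a1 : 0 < nrm (a : K) + 1 by have := nrm_ge0 (a : K); lra.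
have [|f' sf' ff'] := fP (e / 2 / (nrm (a : K) + 1)); first by rewrite !divr_gt0.
have [|g' sg' gg'] := gP (e / 2); first by lra.
exists (fun n => a * f' n + g' n).
  exact: (simple_comp2 HA (fun x y => a * x + y) sf' sg').
move=> n.
have -> : (a *: f + g) n - (a * f' n + g' n) = a * (f n - f' n) + (g n - g' n) :> K.
  have -> : (a *: f + g) n = a * f n + g n by [].
  ring.
apply: le_trans (nrmD _ _) _; rewrite nrmM.
have := ff' n; rewrite ler_pdivlMr// => h1; have := gg' n.
have := nrm_ge0 (f n - f' n : K); nra.
Qed.

HB.instance Definition _ := GRing.isSubmodClosed.Build K (nat -> K^o)
  approximable approximable_submod_closed.

Record hspace := Hspace {
  hfun :> nat -> K^o;
  hfunP : hfun \in approximable }.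

HB.instance Definition _ := [isSub for hfun].
HB.instance Definition _ := [Choice of hspace by <:].
HB.instance Definition _ := [SubChoice_isSubLmodule of hspace by <:].

Lemma hspace_addE (f g : hspace) n : (f + g) n = f n + g n.
Proof. by []. Qed.

Lemma hspace_scaleE a (f : hspace) n : (a *: f) n = a * f n.
Proof. by []. Qed.

Lemma hspace_oppE (f : hspace) n : (- f) n = - f n.
Proof. by []. Qed.

Definition hnorm (f : hspace) : K := sup_norm setT f.

Let setT0 : [set: nat] !=set0. Proof. by exists 0%N. Qed.

Lemma hspace_bounded (f : hspace) :
  exists M, forall n, [set: nat] n -> `|f n| <= M.
Proof.
have /asboolP/(_ 1 ltr01)[g sg fg] := hfunP f.
have sng : simple A (fun n => nrm (g n)) by exact: (simple_comp HA (@nrm R s)).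
have [c cP] := simple_bounded sng.
exists (emb (1 + c)) => n _; rewrite norm_le_emb.
have -> : f n = (f n - g n) + g n :> K by ring.
by apply: le_trans (nrmD _ _) _; rewrite lerD.
Qed.

Let ler_hnormD u v : hnorm (u + v) <= hnorm u + hnorm v.
Proof.
rewrite /hnorm (_ : hfun (u + v) = (fun n => u n + v n)).
  exact: (sup_normD setT0 (hspace_bounded u) (hspace_bounded v)).
by apply/funext => n; rewrite hspace_addE.
Qed.

Let hnormZ a u : hnorm (a *: u) = `|a| * hnorm u.
Proof.
rewrite /hnorm (_ : hfun (a *: u) = (fun n => a * u n)).
  exact: (sup_normZ setT0 a (hspace_bounded u)).
by apply/funext => n; rewrite hspace_scaleE.
Qed.

Let hnorm0_eq0 u : hnorm u = 0 -> u = 0.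
Proof.
move=> u0; apply/val_inj/funext => n.
exact: (sup_norm_eq0 setT0 (hspace_bounded u) u0).
Qed.

HB.instance Definition _ := Lmodule_isNormed.Build K hspace
  ler_hnormD hnormZ hnorm0_eq0.

Lemma nrm_le_vnrm (f : hspace) n : nrm (f n : K) <= vnrm f.
Proof.
rewrite -norm_le_emb -norm_vnrm.
exact: (@le_sup_norm R s nat setT setT0 f n (hspace_bounded f)).
Qed.

Lemma vnrm_le (f : hspace) c : (forall n, nrm (f n : K) <= c) -> vnrm f <= c.
Proof.
move=> fc; rewrite -(ler_emb s) -norm_vnrm.
by apply: (sup_norm_le setT0) => n _; rewrite norm_le_emb.
Qed.

Lemma hspace_subE (f g : hspace) n : (f - g) n = f n - g n :> K.
Proof. by rewrite hspace_addE hspace_oppE. Qed.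

(** Pointwise limits are taken along a free ultrafilter, so that only bounded
    sequences of scalars are involved. *)
Lemma hspace_complete (F : set_system hspace) : ProperFilter F -> cauchy F -> cvg F.
Proof.
move=> FF /cauchyP cF.
have [U UU Uoo] := exists_ultra_oo.
have FU : ProperFilter U := ultra_proper.
pose eps j : R := j.+1%:R^-1.
have eps0 j : 0 < eps j by rewrite invr_gt0.
have eps_anti i j : (i <= j)%N -> eps j <= eps i.
  by move=> ij; rewrite lef_pV2 ?posrE// ler_nat.
have /choice[f fP] j : exists f : hspace, F [set g | vnrm (f - g) < eps j].
  have [|f] := cF (emb (eps j)); first by rewrite -emb0 ltr_emb.
  by rewrite vball; exists f.
(* The filter gives a Cauchy sequence [f], which converges pointwise to [g]. *)
have ff j l n : nrm (f j n - f l n : K) <= eps j + eps l.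
  have [g [/= gj gl]] : exists g, vnrm (f j - g) < eps j /\ vnrm (f l - g) < eps l.
    exact: filter_ex (filterI (fP j) (fP l)).
  have -> : f j n - f l n = (f j n - g n) - (f l n - g n) :> K by ring.
  apply: le_trans (nrmB _ _) _; rewrite -!hspace_subE.
  by apply: lerD; [exact: le_trans (nrm_le_vnrm _ n) (ltW gj)|exact: le_trans (nrm_le_vnrm _ n) (ltW gl)].
have bnd n l : nrm (f l n : K) <= nrm (f 0%N n : K) + 2 * eps 0%N.
  have -> : f l n = (f l n - f 0%N n) + f 0%N n :> K by ring.
  by apply: le_trans (nrmD _ _) _; have := ff l 0%N n; have := eps_anti 0%N l isT; lra.
pose g n : K := ulim U (fun l => f l n : K).
have gP n : ultra_to U (fun l => f l n : K) (g n).
  exact: (ulimP UU (bnd n)).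
have fg j n : nrm (f j n - g n) <= 2 * eps j.
  have to : ultra_to U (fun l => f j n - f l n : K) (f j n - g n).
    move=> e e0; apply: filterS (gP n e e0) => l /=.
    have -> : f j n - f l n - (f j n - g n) = - (f l n - g n) :> K by ring.
    by rewrite nrmN.
  apply: (ultra_to_le UU to).
  have : U [set l | (j <= l)%N] by apply: Uoo; exists j.
  by apply: filterS => l /= jl; have := ff j l n; have := eps_anti _ _ jl; lra.
have epse e : 0 < e -> exists j, eps j < e.
  move=> e0; exists (Num.bound e^-1).
  rewrite /eps invf_plt ?posrE//; apply: lt_trans (archi_boundP _) _.
    by rewrite invr_ge0 ltW.
  by rewrite ltr_nat.
have ga : (g : nat -> K^o) \in approximable.
  apply/asboolP => e e0; have [|j je] := epse (e / 4); first by lra.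
  have e2 : 0 < e / 2 by lra.
  have /asboolP/(_ _ e2)[h sh fh] := hfunP (f j).
  exists h => // n; have -> : g n - h n = (f j n - h n) - (f j n - g n) by ring.
  apply: le_trans (nrmB _ _) _; have := fh n; have := fg j n; lra.
apply/cvg_ex; exists (Hspace ga); apply/cvg_ballP => e e0.
have [|j je] := epse (rp e / 4).
  have := ge0_emb (ltW e0); move: e0 => /[swap] ->.
  by rewrite -emb0 ltr_emb rp_emb; lra.
apply: filterS (fP j) => h /= hj.
rewrite (ge0_emb (ltW e0)) vball /=.
have -> : Hspace ga - h = (Hspace ga - f j) + (f j - h) by rewrite addrA subrK.
apply: le_lt_trans (vnrmD _ _) _.
have : vnrm (Hspace ga - f j) <= 2 * eps j.
  by apply: vnrm_le => n; rewrite hspace_subE nrmC; exact: fg.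
have := eps0 j; lra.
Qed.

HB.instance Definition _ := Uniform_isComplete.Build hspace hspace_complete.

End space.

(** * Continuous functionals on the space *)

Section dual_facts.
Variables (R : realType) (s : scalars).
Local Notation K := (scalar_field R s).
Variable V : normedModType K.
Implicit Types (phi psi : dual V) (v w : V).

Lemma dualD phi v w : phi (v + w) = phi v + phi w.
Proof.
have /asboolP[lf _] := dual_funP phi.
by have := lf 1 v w; rewrite !scale1r.
Qed.

Lemma dual0 phi : phi 0 = 0.
Proof. by apply: (addrI (phi 0)); rewrite -dualD !addr0. Qed.

Lemma dualZ phi a v : phi (a *: v) = a * phi v.
Proof.
have /asboolP[lf _] := dual_funP phi.
by have := lf a v 0; rewrite !addr0 dual0 addr0.
Qed.

Lemma dualB phi v w : phi (v - w) = phi v - phi w.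
Proof. by rewrite dualD -scaleN1r dualZ mulN1r. Qed.

Lemma dual_subE phi psi v : (phi - psi) v = phi v - psi v.
Proof. by rewrite dual_addE -scaleN1r dual_scaleE mulN1r. Qed.

Lemma dual_sumE n (phi : nat -> dual V) (t : nat -> K) v :
  (\sum_(i < n) t i *: phi i) v = \sum_(i < n) t i * phi i v.
Proof.
elim: n => [|n IH].
  rewrite !big_ord0; have := dual_scaleE 0 (0 : dual V) v.
  by rewrite scale0r mul0r.
have -> : \sum_(i < n.+1) t i *: phi i = \sum_(i < n) t i *: phi i + t n *: phi n.
  by rewrite big_ord_recr.
by rewrite dual_addE IH dual_scaleE big_ord_recr.
Qed.

Lemma dual_le_ball phi v : vnrm v <= 1 -> nrm (phi v : K) <= vnrm phi.
Proof.
move=> /unit_ballE v1; rewrite -norm_le_emb -norm_vnrm.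
apply: le_sup_norm => //; last exact: dual_bounded.
by exists 0; apply/unit_ballE; rewrite vnrm0.
Qed.

Lemma dual_le phi v : nrm (phi v : K) <= vnrm phi * vnrm v.
Proof.
have [v0|v0] := eqVneq (vnrm v) 0.
  by rewrite (vnrm_eq0 v0) dual0 vnrm0 mulr0 nrm0.
have vp : 0 < vnrm v by rewrite lt0r v0 vnrm_ge0.
have : nrm (phi (emb (vnrm v)^-1 *: v) : K) <= vnrm phi.
  by apply: dual_le_ball; rewrite vnrmZ nrm_emb ger0_norm ?invr_ge0 ?vnrm_ge0// mulVf.
by rewrite dualZ nrmM nrm_emb ger0_norm ?invr_ge0 ?vnrm_ge0// ler_pdivrMl// mulrC.
Qed.

Lemma dual_norm_le phi c : (forall v, vnrm v <= 1 -> nrm (phi v : K) <= c) -> vnrm phi <= c.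
Proof.
move=> h; rewrite -(ler_emb s) -norm_vnrm; apply: sup_norm_le.
  by exists 0; apply/unit_ballE; rewrite vnrm0.
by move=> v /unit_ballE v1; rewrite norm_le_emb; exact: h.
Qed.

Lemma dual_approx phi c : c < vnrm phi -> exists2 v, vnrm v <= 1 & c < nrm (phi v : K).
Proof.
move=> cphi; apply: contrapT => h; move: cphi; apply/negP; rewrite -leNgt.
apply: dual_norm_le => v v1; rewrite leNgt; apply/negP => cv; apply: h.
by exists v.
Qed.

Lemma make_dual (f : V -> K) (C : R) : (forall a v w, f (a *: v + w) = a * f v + f w) ->
  (forall v, nrm (f v) <= C * vnrm v) -> exists phi : dual V, forall v, phi v = f v.
Proof.
move=> lf fC; suff fP : (f : V -> K^o) \in @continuous_functional R s V by exists (Dual fP).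
apply/asboolP; split; first exact: lf.
move=> v; apply/cvg_ballP => e e0.
have ee := ge0_emb (ltW e0).
have re0 : 0 < rp e by rewrite -(ltr_emb s) -ee emb0.
have C1 : 0 < `|C| + 1 by rewrite ltr_wpDl.
apply/nbhs_ballP; exists (emb (rp e / (`|C| + 1))) => /=.
  by rewrite -emb0 ltr_emb divr_gt0.
rewrite vball => w /= vw; rewrite ee; rewrite -ball_normE /ball_ /=.
rewrite norm_lt_emb.
have -> : f v - f w = f (v - w).
  have f0 : f 0 = 0.
    have := lf 1 0 0; rewrite scaler0 addr0 mul1r => h.
    by apply: (addrI (f 0)); rewrite -h addr0.
  have := lf (-1) w v; rewrite scaleN1r addrC => ->.
  by rewrite mulN1r addrC.
apply: le_lt_trans (fC _) _; move: vw; rewrite ltr_pdivlMr// => vw.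
have := vnrm_ge0 (v - w); have := ler_norm C; nra.
Qed.
End dual_facts.

Section embedding.
Variables (R : realType) (s : scalars) (B : {A | haydon A}).
Local Notation K := (scalar_field R s).
Local Notation A := (projT1 B).
Local Notation X := (hspace R s B).
Let HA : haydon A := projT2 B.
Implicit Types (f g : nat -> K) (phi : dual X).

Definition to_space f : X :=
  if pselect ((f : nat -> K^o) \in @approximable R s B) is left fP then Hspace fP else 0.

Lemma to_spaceE f n : simple A f -> to_space f n = f n.
Proof.
by move=> /simple_approximable fP; rewrite /to_space; case: pselect.
Qed.

Lemma hspace_ext (u v : X) : (forall n, u n = v n :> K) -> u = v.
Proof. by move=> uv; apply/val_inj/funext. Qed.

Lemma vnrm_to_space f c : simple A f -> (forall n, nrm (f n) <= c) -> vnrm (to_space f) <= c.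
Proof. by move=> sf fc; apply: vnrm_le => n; rewrite to_spaceE. Qed.

Definition on_simple phi : (nat -> K) -> K := fun f => phi (to_space f).

Lemma functional_on_simple phi C : vnrm phi <= C -> functional A C (on_simple phi).
Proof.
move=> phiC; split.
- move=> f h sf sh; rewrite /on_simple -dualD; congr (dual_fun phi _); apply: hspace_ext => n.
  by rewrite hspace_addE !to_spaceE//; exact: (simple_comp2 HA +%R).
- move=> c f sf; rewrite /on_simple -dualZ; congr (dual_fun phi _); apply: hspace_ext => n.
  by rewrite hspace_scaleE !to_spaceE//; exact: simpleM.
- move=> f c sf fc; have v1 := vnrm_to_space sf fc.
  have c0 : 0 <= c := le_trans (vnrm_ge0 _) v1.
  apply: le_trans (dual_le _ _) _; apply: ler_pM => //; exact: vnrm_ge0.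
Qed.

Lemma simple_ball_dense (x : X) e : vnrm x <= 1 -> 0 < e ->
  exists2 y, in_ball A y & vnrm (x - to_space y) <= e.
Proof.
move=> x1 e0; have e2 : 0 < e / 2 by lra.
have /asboolP/(_ _ e2)[g sg xg] := hfunP x.
have e1 : 0 < 1 + e / 2 by lra.
have g1 n : nrm (g n) <= 1 + e / 2.
  have -> : g n = x n - (x n - g n) by ring.
  apply: le_trans (nrmB _ _) _; have := xg n; have := nrm_le_vnrm x n; lra.
pose y n := emb (1 + e / 2)^-1 * g n.
have sy : simple A y by exact: simpleM.
have e1' : `|(1 + e / 2)^-1| = (1 + e / 2)^-1 by rewrite ger0_norm// invr_ge0 ltW.
exists y.
  by split=> // n; rewrite /y nrmM nrm_emb e1' mulrC ler_pdivrMr// mul1r.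
apply: vnrm_le => n; rewrite hspace_subE to_spaceE//.
have -> : x n - y n = (x n - g n) + emb (1 - (1 + e / 2)^-1) * g n.
  by rewrite /y embB emb1; ring.
apply: le_trans (nrmD _ _) _; rewrite nrmM nrm_emb.
have -> : `|1 - (1 + e / 2)^-1| = 1 - (1 + e / 2)^-1.
  by rewrite ger0_norm// subr_ge0 invf_le1//; lra.
have : (1 - (1 + e / 2)^-1) * nrm (g n) <= (1 - (1 + e / 2)^-1) * (1 + e / 2).
  by rewrite ler_wpM2l// subr_ge0 invf_le1//; lra.
rewrite mulrBl [X in _ <= X]mulrBl mulVf; last by lra.
have := xg n; lra.
Qed.

(** The weighted sum [psi] of the functionals has norm at least [d] times the
    total weight, because [F] takes such a value on it; [psi] nearly attains
    its norm at a simple function, after rotation. *)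
Lemma bidual_duality (F : dual (dual X)) (phi : nat -> dual X) d e :
  vnrm F <= 1 -> (forall k, d <= rp (F (phi k))) -> 0 < e ->
  forall n (t : nat -> R), (forall i, 0 <= t i) -> exists2 y, in_ball A y &
    (d - e) * (\sum_(i < n) t i) <= \sum_(i < n) t i * rp (on_simple (phi i) y).
Proof.
move=> F1 Fd e0 n t t0.
have S0 : 0 <= \sum_(i < n) t i by apply: sumr_ge0.
have [Sz|Snz] := eqVneq (\sum_(i < n) t i) 0.
  exists (fun=> 0); first by split=> [|m]; [exact: simple_cst|rewrite nrm0].
  rewrite Sz mulr0; apply: sumr_ge0 => i _.
  suff -> : t i = 0 by rewrite mul0r.
  apply/eqP; rewrite eq_le t0 andbT -Sz (bigD1 i)//= lerDl.
  by apply: sumr_ge0.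
have Sp : 0 < \sum_(i < n) t i by rewrite lt0r Snz.
pose psi : dual X := \sum_(i < n) emb (t i) *: phi i.
have rp_sum m (a : nat -> K) : rp (\sum_(i < m) emb (t i) * a i) = \sum_(i < m) t i * rp (a i).
  elim: m => [|m IH]; first by rewrite !big_ord0 -emb0 rp_emb.
  by rewrite !big_ord_recr /= rpD IH rpZ.
have Fpsi : F psi = \sum_(i < n) emb (t i) * F (phi i).
  rewrite /psi; elim: (n) => [|m IH]; first by rewrite !big_ord0 dual0.
  by rewrite !big_ord_recr /= dualD IH dualZ.
have psi_ge : d * (\sum_(i < n) t i) <= vnrm psi.
  apply: (@le_trans _ _ (rp (F psi))).
    by rewrite Fpsi (rp_sum n (fun i => F (phi i) : K)) mulr_sumr; apply: ler_sum => i _; rewrite mulrC ler_wpM2l.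
  apply: le_trans (rp_le_nrm _) _; apply: le_trans (dual_le _ _) _.
  by rewrite ler_piMl// vnrm_ge0.
have eS : 0 < e / 2 * (\sum_(i < n) t i) by rewrite mulr_gt0//; lra.
have [|x x1 xpsi] := @dual_approx _ _ _ psi ((d - e / 2) * (\sum_(i < n) t i)).
  by lra.
have [u u1 uE] := rotation (psi x : K).
have ux1 : vnrm (u *: x) <= 1 by rewrite vnrmZ u1 mul1r.
have psi0 : 0 < vnrm psi + 1 by have := vnrm_ge0 psi; lra.
have [|y by_ yx] := @simple_ball_dense (u *: x)
    (e / 2 * (\sum_(i < n) t i) / (vnrm psi + 1)) ux1.
  by rewrite divr_gt0.
exists y => //.
have -> : \sum_(i < n) t i * rp (on_simple (phi i) y) = rp (psi (to_space y) : K).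
  by rewrite /psi (dual_sumE n phi (fun i => emb (t i))) (rp_sum n (fun i => on_simple (phi i) y)).
have : nrm (psi (u *: x - to_space y) : K) <= e / 2 * (\sum_(i < n) t i).
  apply: le_trans (dual_le _ _) _; move: yx; rewrite ler_pdivlMr//.
  have := vnrm_ge0 (u *: x - to_space y); lra.
move=> /(le_trans (rp_le_nrm _)); rewrite dualB rpB dualZ uE rp_emb => h.
move: (\sum_(i < n) t i) (nrm (psi x : K)) (rp (psi (to_space y) : K)) xpsi h => S a b.
lra.
Qed.
End embedding.

(** * Suprema and cluster points *)

Section suprema.
Variables (R : realType) (s : scalars).
Local Notation K := (scalar_field R s).
Implicit Types (S : set K) (c : R).

Lemma le_supremum S c z : (forall a, S a -> 0 <= a) -> (forall a, S a -> a <= emb c) ->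
  S z -> z <= supremum 0 S.
Proof.
move=> S0 Sc Sz; rewrite /supremum; case: eqP => [E|_]; first by rewrite E in Sz.
case: xgetP => [y -> [ub _]|no]; first exact: ub.
have [|y yP] := @nneg_supremums R s S (ex_intro _ z Sz) S0; last by have := no y yP.
by exists (emb c).
Qed.

Lemma supremum_le S c : (forall a, S a -> 0 <= a) -> 0 <= c ->
  (forall a, S a -> a <= emb c) -> supremum 0 S <= emb c.
Proof.
move=> S0 c0 Sc; rewrite /supremum; case: eqP => [_|E]; first by rewrite -emb0 ler_emb.
case: xgetP => [y -> [_ least]|_]; first exact: least.
by rewrite -emb0 ler_emb.
Qed.

Lemma supremum_ge0 S : (forall a, S a -> 0 <= a) -> 0 <= supremum 0 S.
Proof.
move=> S0; rewrite /supremum; case: eqP => [//|E].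
case: xgetP => [y -> [ub _]|//].
have [z Sz] : S !=set0 by apply/set0P/eqP.
exact: le_trans (S0 z Sz) (ub z Sz).
Qed.

Lemma clustP (a : nat -> K) p : clust a p <->
  forall e : R, 0 < e -> forall N, exists2 n, (N <= n)%N & nrm (a n - p) < e.
Proof.
split=> [ap e e0 N|h].
  have [||z [[n Nn <-] zp]] := ap (a @` [set n | (N <= n)%N]) (ball (p : K^o) (emb e)).
  - by exists N => // n /= Nn; exists n.
  - by apply: nbhsx_ballx; rewrite -emb0 ltr_emb.
  exists n => //; move: zp; rewrite -ball_normE /ball_ /=.
  by rewrite norm_lt_emb nrmC.
move=> S T [N _ NS] /nbhs_ballP[e /= e0 eT].
have ee := ge0_emb (ltW e0).
have re0 : 0 < rp e by rewrite -(ltr_emb s) -ee emb0.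
have [n Nn np] := h _ re0 N; exists (a n); split; first exact: NS.
by apply: eT; rewrite -ball_normE /ball_ /= ee norm_lt_emb nrmC.
Qed.

Lemma clust_bounded (a : nat -> K) C p : (forall n, nrm (a n) <= C) -> clust a p -> nrm p <= C.
Proof.
move=> aC /clustP ap; apply/ler_addgt0Pr => e e0; have [n _ np] := ap e e0 0%N.
have : nrm p <= nrm (a n) + nrm (a n - p) by apply: le_trans (nrmB _ _); rewrite subKr.
have := aC n; lra.
Qed.

Lemma diam_ge0 (S : set K) : 0 <= diam S.
Proof. by apply: supremum_ge0 => _ [x _ <-]. Qed.

Lemma diam_clust_le (a : nat -> K) c : 0 <= c ->
  (forall p q, clust a p -> clust a q -> nrm (p - q) <= c) -> diam (clust a) <= emb c.
Proof.
move=> c0 h; apply: supremum_le => //; first by move=> _ [x _ <-].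
by move=> _ [[p q] [/= ap aq] <-]; rewrite norm_le_emb; exact: h.
Qed.

Lemma le_diam_clust (a : nat -> K) C p q : (forall n, nrm (a n) <= C) ->
  clust a p -> clust a q -> emb (nrm (p - q)) <= diam (clust a).
Proof.
move=> aC ap aq; rewrite -norm_emb; apply: (@le_supremum _ (C + C)).
- by move=> _ [x _ <-].
- move=> _ [[p' q'] [/= ap' aq'] <-]; rewrite norm_le_emb.
  by apply: le_trans (nrmB _ _) _; rewrite lerD// (clust_bounded aC).
- by exists (p, q).
Qed.

Lemma clust_ultra (a : nat -> K) (m : nat -> nat) U l : UltraFilter U -> \oo `<=` U ->
  (forall k, (k <= m k)%N) -> ultra_to U (fun k => a (m k)) l -> clust a l.
Proof.
move=> UU Uoo km al; apply/clustP => e e0 N.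
have FU : ProperFilter U := ultra_proper.
have UN : U [set k | (N <= k)%N] by apply: Uoo; exists N.
have [k [/= Nk kl]] : exists k, (N <= k)%N /\ nrm (a (m k) - l) < e.
  exact: filter_ex (filterI UN (al e e0)).
by exists (m k) => //; exact: leq_trans (km k).
Qed.
End suprema.

(** * The Grothendieck property with constant 1 *)

Section grothendieck.
Variables (R : realType) (s : scalars) (B : {A | haydon A}).
Local Notation K := (scalar_field R s).
Local Notation A := (projT1 B).
Local Notation X := (hspace R s B).
Let HA : haydon A := projT2 B.

(** Two cluster points [p], [q] of [F (f n)] give functionals [phi k], rotated
    differences of terms of [f], on which [F] is about [nrm (p - q)].  A point
    [x] at which infinitely many of them are about as large yields two cluster
    points of [f n x] at that distance. *)
Theorem grothendieck_hspace : grothendieck X 1.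
Proof.
move=> f bf; rewrite mul1r.
have [C0 C00 fC] : exists2 C, 0 <= C & forall n, vnrm (f n) <= C.
  have [M [_ Mf]] := bf; have := Mf (M + 1); rewrite ltrDl ltr01 => /(_ isT) h.
  have hn n : `|f n| <= M + 1 by exact: h.
  have M0 : 0 <= M + 1 := le_trans (normr_ge0 _) (hn 0%N).
  exists (rp (M + 1)); first by rewrite -(ler_emb s) -ge0_emb// emb0.
  by move=> n; rewrite -(ler_emb s) -ge0_emb// -norm_vnrm.
pose D := rp (delta_weak_star f).
have dws0 : 0 <= delta_weak_star f.
  by apply: supremum_ge0 => _ [x _ <-]; exact: diam_ge0.
have DE : delta_weak_star f = emb D by exact: ge0_emb.
have D0 : 0 <= D by rewrite -(ler_emb s) -DE emb0.
have star (x : X) p q : vnrm x <= 1 -> clust (fun n => f n x) p -> clust (fun n => f n x) q ->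
    nrm (p - q) <= D.
  move=> x1 xp xq; rewrite -(ler_emb s) -DE.
  have fx (y : X) n : vnrm y <= 1 -> nrm (f n y : K) <= C0.
    by move=> y1; exact: le_trans (dual_le_ball _ y1) (fC n).
  apply: le_trans (le_diam_clust (C := C0) _ xp xq) _; first by move=> n; exact: fx.
  apply: (@le_supremum _ _ _ (C0 + C0)).
  - by move=> _ [y _ <-]; exact: diam_ge0.
  - move=> _ [y /unit_ballE y1 <-]; apply: diam_clust_le; first by rewrite addr_ge0.
    have yC n : nrm (f n y : K) <= C0 by exact: fx.
    move=> p' q' yp yq; apply: le_trans (nrmB _ _) _.
    by rewrite lerD// (clust_bounded yC).
  - by exists x => //; apply/unit_ballE.
rewrite DE; apply: supremum_le => //; first by move=> _ [F _ <-]; exact: diam_ge0.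
move=> _ [F /unit_ballE F1 <-]; apply: diam_clust_le => // p q Fp Fq.
apply/ler_addgt0Pr => e e0.
have [u u1 uE] := rotation (p - q).
have e8 : 0 < e / 8 by lra.
have /choice[a aP] k : exists n, (k <= n)%N /\ nrm (F (f n) - p : K) < e / 8.
  by have [n] := (clustP _ _).1 Fp _ e8 k; exists n.
have /choice[b bP] k : exists n, (k <= n)%N /\ nrm (F (f n) - q : K) < e / 8.
  by have [n] := (clustP _ _).1 Fq _ e8 k; exists n.
pose phi k : dual X := u *: (f (a k) - f (b k)).
have phiC k : vnrm (phi k) <= C0 + C0.
  rewrite /phi vnrmZ u1 mul1r; apply: le_trans (vnrmD _ _) _.
  by rewrite vnrmN lerD.
have Fphi k : nrm (p - q) - e / 4 <= rp (F (phi k)).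
  have -> : F (phi k) = u * (p - q) + (u * (F (f (a k)) - p) - u * (F (f (b k)) - q)) :> K.
    by rewrite /phi dualZ dualB; ring.
  rewrite uE rpD rp_emb; have := rp_ge_nrm (u * (F (f (a k)) - p) - u * (F (f (b k)) - q)).
  have := nrmB (u * (F (f (a k)) - p)) (u * (F (f (b k)) - q)).
  rewrite [nrm (u * (_ - p))]nrmM [nrm (u * (_ - q))]nrmM u1 !mul1r.
  have [_] := aP k; have [_] := bP k; lra.
have dual := bidual_duality F1 Fphi e8.
have funct k := functional_on_simple (phiC k).
have [x [sx x1] xP] := recurrent_point HA funct dual e8.
have /choice[kk kkP] N : exists k, (N <= k)%N /\ nrm (p - q) - e / 2 <= rp (on_simple (phi k) x).
  by have [k Nk kx] := xP N; exists k; split => //; move: kx; lra.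
have [U UU Uoo] := exists_ultra_oo.
have FU : ProperFilter U := ultra_proper.
have xx1 : vnrm (to_space B x) <= 1 by exact: vnrm_to_space.
have fx n : nrm (f n (to_space B x) : K) <= C0.
  exact: le_trans (dual_le_ball _ xx1) (fC n).
have [l lP] := ultra_cvg UU (a := fun N => f (a (kk N)) (to_space B x)) (fun N => fx _).
have [m mP] := ultra_cvg UU (a := fun N => f (b (kk N)) (to_space B x)) (fun N => fx _).
have cl : clust (fun n => f n (to_space B x)) l.
  apply: (@clust_ultra R s (fun n => f n (to_space B x)) (fun N => a (kk N)) U l) => //.
  by move=> N; apply: leq_trans (aP _).1; exact: (kkP N).1.
have cm : clust (fun n => f n (to_space B x)) m.
  apply: (@clust_ultra R s (fun n => f n (to_space B x)) (fun N => b (kk N)) U m) => //.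
  by move=> N; apply: leq_trans (bP _).1; exact: (kkP N).1.
have lm := star _ _ _ xx1 cl cm.
have [N [/= lN mN]] : exists N, nrm (f (a (kk N)) (to_space B x) - l : K) < e / 8 /\
    nrm (f (b (kk N)) (to_space B x) - m : K) < e / 8.
  exact: filter_ex (filterI (lP _ e8) (mP _ e8)).
have [_] := kkP N; have := rp_le_nrm (on_simple (phi (kk N)) x).
rewrite /on_simple /phi dual_scaleE nrmM u1 mul1r dual_subE.
set fa := f (a _) _ in lN *; set fb := f (b _) _ in mN *.
have : nrm (fa - fb : K) <= nrm (l - m) + (nrm (fa - l : K) + nrm (fb - m : K)).
  have -> : fa - fb = (l - m) + ((fa - l) - (fb - m)) :> K by ring.
  by apply: le_trans (nrmD _ _) _; rewrite lerD2l nrmB.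
move: (rp _) (nrm (fa - fb)) => r1 r2; lra.
Qed.
End grothendieck.

(** * Failure of reflexivity *)

Section nonreflexive.
Variables (R : realType) (s : scalars) (B : {A | haydon A}).
Local Notation K := (scalar_field R s).
Local Notation A := (projT1 B).
Local Notation X := (hspace R s B).
Let HA : haydon A := projT2 B.

Let tail n : nat -> K := fun m => if (m < n)%N then 0 else 1.

Let simple_tail n : simple A (tail n).
Proof.
have AP : A (fun m => (m < n)%N).
  have := alg_has HA (iota 0 n) (alg_one HA); congr A; apply/funext => m.
  rewrite -[RHS]/(0 <= m < 0 + n)%N -mem_iota.
  by apply/hasP/idP => [[j jn /eqP ->//]|mn]; exists m => //; exact: eqxx.
exact: (simple_if HA AP (simple_cst HA (0 : K)) (simple_cst HA (1 : K))).
Qed.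

(** The functional [G] sends [phi] to the limit of its values on the tails.  If
    it were evaluation at [x], the point evaluations would force [x] to be 0,
    whereas [G] is 1 at the ultrafilter limit [psi]. *)
Lemma hspace_not_reflexive : ~ reflexive_space X.
Proof.
move=> refl; have [U UU Uoo] := exists_ultra_oo.
have FU : ProperFilter U := ultra_proper.
have tail1 n : vnrm (to_space B (tail n)) <= 1.
  apply: vnrm_to_space => // m; rewrite /tail; case: ifP => _; by rewrite ?nrm0 ?nrm1.
have bnd (phi : dual X) n : nrm (phi (to_space B (tail n)) : K) <= vnrm phi.
  exact: dual_le_ball.
pose G (phi : dual X) : K := ulim U (fun n => phi (to_space B (tail n)) : K).
have GP (phi : dual X) : ultra_to U (fun n => phi (to_space B (tail n)) : K) (G phi).
  exact: (ulimP UU (bnd phi)).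
have [|phi|F FE] := @make_dual R s (dual X) G 1.
- move=> c phi psi; apply: (ulimE UU).
  have := ultra_toD UU (ultra_toZ UU c (GP phi)) (GP psi).
  congr ultra_to; apply/funext => n; by rewrite dual_addE dual_scaleE.
- by rewrite mul1r; apply: (ultra_to_le UU (GP phi)); apply: filterE => n; exact: bnd.
have [x xF] := refl F.
have x0 : x = 0.
  apply: hspace_ext => k.
  have [|v|phi phiE] := @make_dual R s X (fun f => f k : K) 1.
  - by move=> c f g; rewrite hspace_addE hspace_scaleE.
  - by rewrite mul1r; exact: nrm_le_vnrm.
  have := xF phi; rewrite FE phiE => <-; apply: (ulimE UU) => e e0.
  have : U [set n | (k < n)%N] by apply: Uoo; exists k.+1.
  apply: filterS => n /= kn; rewrite phiE to_spaceE// /tail kn.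
  by rewrite subrr nrm0.
have [|f|psi psiE] := @make_dual R s X (fun f => ulim U (f : nat -> K)) 1.
- move=> c f g; apply: (ulimE UU).
  have lim (h : X) : ultra_to U (hfun h : nat -> K) (ulim U (hfun h : nat -> K)).
    exact: (ulimP UU (fun n => nrm_le_vnrm h n)).
  have := ultra_toD UU (ultra_toZ UU c (lim f)) (lim g).
  by congr ultra_to; apply/funext => n; rewrite hspace_addE hspace_scaleE.
- rewrite mul1r; have to := ulimP UU (fun n => nrm_le_vnrm f n).
  by apply: (ultra_to_le UU to); apply: filterE => n; exact: nrm_le_vnrm.
have : G psi = 1.
  apply: (ulimE UU) => e e0; apply: filterE => n /=.
  rewrite psiE (_ : ulim U _ = 1) ?subrr ?nrm0//.
  apply: (ulimE UU) => e' e'0.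
  have : U [set m | (n <= m)%N] by apply: Uoo; exists n.
  apply: filterS => m /= nm; rewrite to_spaceE// /tail ltnNge nm /=.
  by rewrite subrr nrm0.
rewrite -FE xF x0 dual0 => /(congr1 (@nrm R s)); rewrite nrm0 nrm1.
by move/eqP; rewrite eq_sym oner_eq0.
Qed.
End nonreflexive.

(** * Absence of l^oo *)

Section rosenthal.
Variables (R : realType) (s : scalars).
Local Notation K := (scalar_field R s).
Local Notation L := (linfty R s).
Implicit Types u v : L.

Lemma linfty_le u n : nrm (u n : K) <= vnrm u.
Proof.
rewrite -norm_le_emb -norm_vnrm.
apply: (@le_sup_norm R s nat setT (ex_intro _ 0%N I)) => //.
by have /asboolP[M uM] := linfty_seqP u; exists M => m _.
Qed.

Lemma vnrm_linfty_le u c : (forall n, nrm (u n : K) <= c) -> vnrm u <= c.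
Proof.
move=> uc; rewrite -(ler_emb s) -norm_vnrm; apply: sup_norm_le; first by exists 0%N.
by move=> n _; rewrite norm_le_emb.
Qed.

Definition supported u (M : nat -> bool) k := forall n, u n <> 0 -> M n && (n != k).

(** Induction on a bound, in multiples of [e], for the influence of the other
    coordinates.  Cut the index set into infinitely many infinite parts.  If
    every part has a bad index [k], with a vector of the part on which [mu k]
    exceeds [e], then the set of these bad indices meets each part once, so
    that vectors supported on it can be added to the bad ones without
    increasing the norm; on this set the bound drops by [e]. *)
Lemma rosenthal (mu : nat -> L -> K) (C e : R) :
  (forall k u v, mu k (u + v) = mu k u + mu k v) ->
  (forall k a u, mu k (a *: u) = a * mu k u) ->
  (forall k u, vnrm u <= 1 -> nrm (mu k u) <= C) -> 0 < e ->
  exists2 M, infinite M & forall k, M k -> forall u, vnrm u <= 1 -> supported u M k ->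
    nrm (mu k u) <= e.
Proof.
move=> muD muZ muC e0.
suff H j M0 : infinite M0 -> (forall k, M0 k -> forall u, vnrm u <= 1 -> supported u M0 k ->
    nrm (mu k u) <= j%:R * e) -> exists2 M, infinite M & forall k, M k -> forall u,
    vnrm u <= 1 -> supported u M k -> nrm (mu k u) <= e.
  apply: (H (Num.bound (C / e)) (fun=> true)) => [n|k _ u u1 _]; first by exists n.
  apply: le_trans (muC k u u1) _; rewrite -ler_pdivrMr// ltW// archi_boundP//.
  rewrite divr_ge0 ?(ltW e0)//; apply: le_trans (nrm_ge0 (mu k 0)) (muC _ _ _).
  by rewrite vnrm0.
elim: j M0 => [|j IH] M0 infM M0P.
  exists M0 => // k Mk u u1 su; apply: le_trans (M0P k Mk u u1 su) _.
  by rewrite mul0r ltW.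
have [g gmono gM] := infinite_enum infM.
have ginj : injective g.
  by move=> i i' gii'; have [/gmono|/gmono|//] := ltngtP i i'; rewrite gii' ltnn.
pose N (p n : nat) := `[< exists i : nat, g (pickle (p, i)) = n >].
have infN p : infinite (N p).
  apply: (infinite_range (g := fun i => g (pickle (p, i)))).
  by move=> i i' /ginj /(pcan_inj pickleK)[].
have NM p n : N p n -> M0 n by move=> /asboolP[i <-].
have Ndisj p q n : N p n -> N q n -> p = q.
  by move=> /asboolP[i <-] /asboolP[i' /ginj /(pcan_inj pickleK)[]].
have [[p pP]|nop] := EM (exists p, forall k, N p k -> forall u, vnrm u <= 1 ->
    supported u (N p) k -> nrm (mu k u) <= e).
  by exists (N p).
have /choice[ku kuP] p : exists ku : nat * L, [/\ N p ku.1, vnrm ku.2 <= 1,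
    supported ku.2 (N p) ku.1 & e < nrm (mu ku.1 ku.2)].
  apply: contrapT => h; apply: nop; exists p => k Nk u u1 su.
  by rewrite leNgt; apply/negP => lt; apply: h; exists (k, u).
pose kk p := (ku p).1.
have kinj : injective kk.
  move=> p q kpq; have [Np _ _ _] := kuP p; have [Nq _ _ _] := kuP q.
  by apply: Ndisj Np _; rewrite -/(kk p) kpq.
apply: (IH _ (infinite_range kinj)) => _ /asboolP[p <-] v v1 sv.
have [Np u1 su mue] := kuP p; rewrite -/(kk p) in Np su mue *.
set u := (ku p).2 in u1 su mue.
have [a a1 aE] := rotation (mu (kk p) u); have [b b1 bE] := rotation (mu (kk p) v).
have disj n : u n = 0 :> K \/ v n = 0 :> K.
  apply: contrapT => /not_orP[un vn].
  have /andP[Nn nk] := su n un; have /andP[/asboolP[q qn] _] := sv n vn.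
  have [Nq _ _ _] := kuP q; rewrite -/(kk q) qn in Nq.
  by move: nk; rewrite -qn (Ndisj _ _ _ Nq Nn) eqxx.
have wE n : (a *: u + b *: v) n = a * u n + b * v n.
  by rewrite linfty_addE !linfty_scaleE.
have M0k : M0 (kk p) by exact: NM Np.
have := M0P (kk p) M0k (a *: u + b *: v) _ _.
rewrite muD !muZ aE bE -embD nrm_emb ger0_norm ?addr_ge0 ?nrm_ge0// -natr1 mulrDl mul1r.
move=> h; have {h} : nrm (mu (kk p) u) + nrm (mu (kk p) v) <= j%:R * e + e; last by lra.
apply: h.
  apply: vnrm_linfty_le => n; rewrite wE.
  case: (disj n) => ->; rewrite mulr0 ?addr0 ?add0r nrmM ?a1 ?b1 mul1r.
    exact: le_trans (linfty_le v n) v1.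
  exact: le_trans (linfty_le u n) u1.
move=> n; rewrite wE => wn.
have [un|un] := EM (u n = 0 :> K); last first.
  by have /andP[/NM -> ->] := su n un.
have vn : v n <> 0 :> K by move=> vn; apply: wn; rewrite un vn !mulr0 addr0.
have /andP[/asboolP[q qn] ->] := sv n vn; rewrite andbT -qn.
by have [Nq _ _ _] := kuP q; exact: NM Nq.
Qed.
End rosenthal.

Section no_linfty.
Variables (R : realType) (s : scalars) (B : {A | haydon A}).
Local Notation K := (scalar_field R s).
Local Notation A := (projT1 B).
Local Notation X := (hspace R s B).
Let HA : haydon A := projT2 B.

Definition indicator (P : nat -> bool) : nat -> K := fun n => (P n)%:R.

Lemma indicator_bounded P : (indicator P : nat -> K^o) \in @bounded_seq R s.
Proof.
by apply/asboolP; exists 1 => n; rewrite /indicator; case: (P n); rewrite ?normr1 ?normr0.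
Qed.

Definition linfty_indicator P : linfty R s := Linfty (indicator_bounded P).

Lemma vnrm_indicator P : vnrm (linfty_indicator P) <= 1.
Proof.
by apply: vnrm_linfty_le => n; rewrite /= /indicator; case: (P n); rewrite ?nrm1 ?nrm0.
Qed.

(** On the indices [M] of Rosenthal's lemma, the image under [T] of the
    indicator of [E] is at least [3 * del / 8] in modulus at [n k] for [k] in
    [E], and at most [del / 8] for the other [k] in [M].  A set of the algebra
    separates the two groups of points, so that every subset of the [n k] would
    be a trace. *)
Theorem hspace_no_linfty : ~ contains_linfty X.
Proof.
move=> [T [S [_ cT TS cS]]].
have T0 : T 0 = 0 by exact: linear0.
have S0 : S 0 = 0 by rewrite -T0 TS.
have [C TC] : exists C, forall u, vnrm u <= 1 -> vnrm (T u) <= C.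
  have /linear_bounded_continuous/bounded_funP/(_ 1)[M TM] : continuous T by [].
  have M0 : 0 <= M by apply: le_trans (TM 0 _); rewrite ?normr_ge0 ?normr0.
  exists (rp M) => u u1; rewrite -(ler_emb s) -ge0_emb// -norm_vnrm.
  by apply: TM; rewrite norm_vnrm -emb1 ler_emb.
have [del del0 Tdel] : exists2 del : R, 0 < del & forall u, vnrm (T u) < del -> vnrm u < 1.
  have /cvg_ballP : S @ within (range T) (nbhs (0 : X)) --> S 0.
    by move/subspace_continuousP: cS; apply; exists 0.
  rewrite S0 => /(_ 1 ltr01) near0.
  have /nbhs_ballP[d /= d0 dP] : nbhs (0 : X)
    [set y | range T y -> ball (0 : linfty R s) (1 : K) (S y)] by exact: near0.
  exists (rp d); first by rewrite -(ltr_emb s) -ge0_emb ?ltW// emb0.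
  move=> u Tu; have := dP (T u); rewrite (ge0_emb (ltW d0)) vball /= sub0r vnrmN.
  move=> /(_ Tu)/(_ (ex_intro2 _ _ u I erefl)); rewrite TS -emb1 vball /=.
  by rewrite sub0r vnrmN.
pose basis k := linfty_indicator (fun m => m == k).
have /choice[n nP] k : exists n, del / 2 <= nrm (T (basis k) n : K).
  apply: contrapT => h.
  have : vnrm (basis k) < 1.
    apply: Tdel; apply: (@le_lt_trans _ _ (del / 2)); last by lra.
    apply: vnrm_le => n; rewrite leNgt; apply/negP => lt; apply: h; exists n; exact: ltW.
  have := linfty_le (basis k) k; rewrite /= /indicator eqxx nrm1; lra.
have e0 : 0 < del / 8 by lra.
have [|||M infM MP] := @rosenthal R s (fun k u => T u (n k)) C (del / 8) _ _ _ e0.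
- by move=> k u v; rewrite linearD hspace_addE.
- by move=> k a u; rewrite linearZ hspace_scaleE.
- by move=> k u u1; apply: le_trans (nrm_le_vnrm _ _) (TC _ u1).
have [g gmono gM] := infinite_enum infM.
have ninj : injective (n \o g).
  move=> i j /= nij; apply: contrapT => /eqP ij.
  have gij : g j != g i.
    apply: contra ij => /eqP gij.
    by have [/gmono|/gmono|//] := ltngtP i j; rewrite gij ltnn.
  have : nrm (T (basis (g j)) (n (g i)) : K) <= del / 8.
    apply: MP => //; first exact: vnrm_indicator.
    move=> m; rewrite /= /indicator; case: eqP => [->|//] _; by rewrite gM gij.
  by rewrite nij; have := nP (g j); lra.
have [P PP] := alg_traceless HA (infinite_range ninj).
pose E k := M k && P (n k).
have e16 : 0 < del / 16 by lra.
have /asboolP/(_ _ e16)[f sf Tf] := hfunP (T (linfty_indicator E)).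
(* The threshold del / 4 separates 3 del / 8 from del / 8 with room for the
   approximation error del / 16. *)
have AQ : A (fun m => del / 4 < nrm (f m)) by exact: (simple_preim HA (fun z => del / 4 < nrm z)).
have [_ /asboolP[i <-] /=] := PP _ AQ; set k := g i; apply.
have Mk : M k by exact: gM.
have fk : nrm (f (n k)) <= nrm (T (linfty_indicator E) (n k) : K) + del / 16.
  have := nrmB (T (linfty_indicator E) (n k) : K) (T (linfty_indicator E) (n k) - f (n k)).
  by rewrite subKr; have := Tf (n k); lra.
have fk' : nrm (T (linfty_indicator E) (n k) : K) <= nrm (f (n k)) + del / 16.
  have := nrmD (f (n k)) (T (linfty_indicator E) (n k) - f (n k)).
  by rewrite addrC subrK; have := Tf (n k); lra.
have [Pk|nPk] := boolP (P (n k)); last first.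
  apply/negbTE; rewrite -leNgt.
  have : nrm (T (linfty_indicator E) (n k) : K) <= del / 8.
    apply: MP => //; first exact: vnrm_indicator.
    move=> m; rewrite /= /indicator /E; have [->|mk] := eqVneq m k.
      by rewrite (negbTE nPk) andbF.
    by case: (M m).
  lra.
suff lt_f : del / 4 < nrm (f (n k)) by rewrite lt_f.
pose E' m := E m && (m != k).
have EE : linfty_indicator E = basis k + linfty_indicator E'.
  apply/val_inj/funext => m; rewrite -[RHS]/((basis k + linfty_indicator E') m : K) linfty_addE.
  rewrite /= /indicator /E'; have [->|mk] := eqVneq m k; last by rewrite add0r andbT.
  by rewrite /E Mk Pk /= addr0.
have : nrm (T (linfty_indicator E') (n k) : K) <= del / 8.
  apply: MP => //; first exact: vnrm_indicator.
  by move=> m; rewrite /= /indicator /E' /E; case: (M m); case: (m != k); rewrite ?andbF.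
have Tsum : T (basis k) (n k) = T (linfty_indicator E) (n k) - T (linfty_indicator E') (n k) :> K.
  by rewrite EE linearD hspace_addE addrK.
have := nrmB (T (linfty_indicator E) (n k) : K) (T (linfty_indicator E') (n k)).
rewrite -Tsum; have := nP k; lra.
Qed.
End no_linfty.

Theorem corollary1p5 (R : realType) (s : scalars) :
  exists X : completeNormedModType (scalar_field R s),
    [/\ ~ reflexive_space X, grothendieck X 1%R & ~ contains_linfty X].
Proof.
have [A HA] := exists_haydon; pose B : {A | haydon A} := exist _ A HA.
exists (hspace R s B); split.
- exact: hspace_not_reflexive.
- exact: grothendieck_hspace.
- exact: hspace_no_linfty.
Qed.
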